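(* Let $G$ be a compact connected Lie group whose Lie algebra $\mathfrak g$ carries an $\mathrm{Ad}$-invariant inner product $\langle\cdot,\cdot\rangle$, acting on itself by conjugation, and let $\eta\in\Omega^3(G)$ be the Cartan $3$-form. Let $M$ be a $G$-manifold, $\omega\in\Omega^2(M)^G$, and $\mu\colon M\to G$ an equivariant map satisfying (QH1) $d\omega=\mu^*\eta$; (QH2) $\iota_{v_x}\omega=\tfrac12\mu^*\langle\theta^L+\theta^R,x\rangle$ for all $x\in\mathfrak g$. Then $\varpi:=(\eta,\omega)\in\Omega^3(\mu)=\Omega^3(G)\oplus\Omega^2(M)$ is $d_\mu$-closed, i.e. a relative pre-$2$-plectic structure on $\mu\colon M\to G$. If moreover (QH3) $\ker\omega_m=\{v_x(m):x\in\ker(\mathrm{Ad}_{\mu(m)}+\mathrm{id})\}$ at each $m\in M$, then $\varpi$ is nondegenerate, i.e. $(\mu,\varpi)$ is a relative $2$-plectic map. Conversely, nondegeneracy of $\varpi$ implies $\ker\omega_m\cap\ker T_m\mu=\{0\}$ for all $m\in M$.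
   Context: All manifolds, maps, forms and actions are smooth. $\theta^L,\theta^R\in\Omega^1(G;\mathfrak g)$ are the left- and right-invariant Maurer–Cartan forms; $\eta=\tfrac1{12}\langle\theta^L,[\theta^L,\theta^L]\rangle$. Fundamental vector fields: $v_x|_p=\frac{d}{dt}|_{t=0}\exp(-tx)\cdot p$ (so for conjugation on $G$, $v_x=v_x^L-v_x^R$, the left- minus the right-invariant vector field generated by $x$). For $\mu\colon M\to G$: $\Omega^k(\mu)=\Omega^k(G)\oplus\Omega^{k-1}(M)$, $d_\mu(\alpha,\beta)=(d\alpha,\,\mu^*\alpha-d\beta)$. A relative pre-$2$-plectic structure on $\mu$ is a $d_\mu$-closed element $(\eta,\omega)\in\Omega^3(\mu)$. It is nondegenerate (a relative $2$-plectic structure; $(\mu,\varpi)$ is then called a relative $2$-plectic map) if for every $m\in M$ the linear map $T_mM\to\Lambda^2T^*_{\mu(m)}G\oplus T_m^*M$, $w\mapsto(\iota_{T_m\mu(w)}\eta_{\mu(m)},\,\iota_w\omega_m)$, is injective. *)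

(* Defs.v *)
From HB Require Import structures.
From mathcomp Require Import all_boot all_order all_algebra.
From mathcomp Require Import all_classical all_reals all_analysis.

Set Implicit Arguments.
Unset Strict Implicit.
Unset Printing Implicit Defensive.

Import Order.TTheory GRing.Theory Num.Theory.
Import numFieldNormedType.Exports.

Local Open Scope classical_set_scope.
Local Open Scope ring_scope.

(** * Smooth manifolds *)

(* Meant for open [U]. *)
Fixpoint C_on (R : realType) (E F : normedModType R) (k : nat)
    (U : set E) (f : E -> F) : Prop :=
  if k is k'.+1 then
    (forall x, U x -> differentiable f x) /\
    (forall v : E, C_on k' U (fun x => 'd f x v))
  else forall x, U x -> {for x, continuous f}.

Definition smooth_on (R : realType) (E F : normedModType R)
  (U : set E) (f : E -> F) : Prop := forall k, C_on k U f.

Record chart (R : realType) (M : topologicalType) (n : nat) := Chart {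
  chart_dom : set M ;
  chart_map :> M -> 'rV[R]_n ;
  chart_inv : 'rV[R]_n -> M ;
  chart_dom_open : open chart_dom ;
  chart_img_open : open (chart_map @` chart_dom) ;
  chart_mapK : {in chart_dom, cancel chart_map chart_inv} ;
  chart_map_continuous :
    forall p, chart_dom p -> {for p, continuous chart_map} ;
  chart_inv_continuous :
    forall y, (chart_map @` chart_dom) y -> {for y, continuous chart_inv} }.

(* The smooth structure is given by an atlas indexed by the points of M: every
   atlas contains a subatlas of this form, hence one inducing the same
   structure.  The chart attached to [p] identifies T_pM with the space of
   coordinates 'rV_(mdim M), which is our model of the tangent space at [p];
   [chart_tangent] and [chart_tangent_inv] below pass from one chart to
   another. *)
HB.mixin Record isManifold (R : realType) M of Topological M := {
  mdim : nat ;
  manifold_chart : M -> chart R M mdim ;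
  manifold_hausdorff : hausdorff_space M ;
  manifold_second_countable : @second_countable M ;
  manifold_mem : forall p, chart_dom (manifold_chart p) p ;
  manifold_compat : forall p q : M,
    smooth_on (manifold_chart p @` (chart_dom (manifold_chart p) `&`
                                    chart_dom (manifold_chart q)))
              (manifold_chart q \o chart_inv (manifold_chart p)) }.

#[short(type="manifoldType")]
HB.structure Definition Manifold (R : realType) :=
  { M of isManifold R M & Topological M }.
Arguments mdim {R} s : rename.

Definition mchart (R : realType) (M : manifoldType R) (p : M)
  : chart R M (mdim M) := manifold_chart p.

Definition smooth_map (R : realType) (M N : manifoldType R) (f : M -> N) :=
  continuous f /\
  forall (p : M) (q : N),
    smooth_on (mchart p @` (chart_dom (mchart p) `&`
                            f @^-1` chart_dom (mchart q)))
              (mchart q \o f \o chart_inv (mchart p)).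

(* Smoothness on the product manifold M x N, written in the product charts. *)
Definition smooth_map2 (R : realType) (M N P : manifoldType R)
    (f : M -> N -> P) :=
  continuous (fun z : M * N => f z.1 z.2) /\
  forall (p : M) (q : N) (r : P),
    smooth_on
      [set y : 'rV[R]_(mdim M) * 'rV[R]_(mdim N) |
        exists a b, [/\ chart_dom (mchart p) a, chart_dom (mchart q) b,
          chart_dom (mchart r) (f a b) & y = (mchart p a, mchart q b)]]
      (fun y => mchart r (f (chart_inv (mchart p) y.1)
                            (chart_inv (mchart q) y.2))).

Definition smooth_curve (R : realType) (M : manifoldType R) (c : R -> M) :=
  continuous c /\
  forall p : M,
    smooth_on (E := R^o) (c @^-1` chart_dom (mchart p)) (mchart p \o c).

Definition velocity (R : realType) (M : manifoldType R) (c : R -> M) (t : R)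
    : 'rV[R]_(mdim M) :=
  'D_(1 : R^o) (mchart (c t) \o c : R^o -> _) t.

(* T_p f : T_p M -> T_(f p) N. *)
Definition tmap (R : realType) (M N : manifoldType R) (f : M -> N) (p : M)
    : 'rV[R]_(mdim M) -> 'rV[R]_(mdim N) :=
  'd (mchart (f p) \o f \o chart_inv (mchart p)) (mchart p p).

(* The differential at [q] of the chart attached to [p], on T_q M. *)
Definition chart_tangent (R : realType) (M : manifoldType R) (p q : M)
    : 'rV[R]_(mdim M) -> 'rV[R]_(mdim M) :=
  'd (mchart p \o chart_inv (mchart q)) (mchart q q).

(* The differential at [y] of the inverse of the chart attached to [p], with
   values in T_q M where q is the point with coordinates [y]. *)
Definition chart_tangent_inv (R : realType) (M : manifoldType R) (p : M)
    (y : 'rV[R]_(mdim M)) : 'rV[R]_(mdim M) -> 'rV[R]_(mdim M) :=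
  'd (mchart (chart_inv (mchart p) y) \o chart_inv (mchart p)) y.

(* [X,Y] = XY - YX as derivations, i.e. DY(X) - DX(Y) in coordinates. *)
Definition vf_bracket (R : realType) (M : manifoldType R)
    (X Y : M -> 'rV[R]_(mdim M)) (p : M) : 'rV[R]_(mdim M) :=
  let loc (Z : M -> 'rV[R]_(mdim M)) (y : 'rV[R]_(mdim M)) :=
    let q := chart_inv (mchart p) y in chart_tangent p q (Z q) in
  'D_(X p) (loc Y) (mchart p p) - 'D_(Y p) (loc X) (mchart p p).

(** * Differential forms *)

Definition preform (R : realType) (M : manifoldType R) (k : nat) :=
  M -> ('I_k -> 'rV[R]_(mdim M)) -> R.

Definition multilinear (R : realType) (V : lmodType R) (k : nat)
    (a : ('I_k -> V) -> R) :=
  forall (i : 'I_k) (u : 'I_k -> V) (c : R) (v w : V),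
    let at_i z := fun j => if j == i then z else u j in
    a (at_i (c *: v + w)) = c * a (at_i v) + a (at_i w).

Definition alternating (R : realType) (V : lmodType R) (k : nat)
    (a : ('I_k -> V) -> R) :=
  forall (u : 'I_k -> V) (i j : 'I_k), i != j -> u i = u j -> a u = 0.

(* The pull-back of [a] by the inverse of the chart attached to [p], a form on
   an open subset of R^n. *)
Definition local_form (R : realType) (M : manifoldType R) (k : nat)
    (a : preform M k) (p : M) (y : 'rV[R]_(mdim M))
    (u : 'I_k -> 'rV[R]_(mdim M)) : R :=
  a (chart_inv (mchart p) y) (fun i => chart_tangent_inv p y (u i)).

Definition is_form (R : realType) (M : manifoldType R) (k : nat)
    (a : preform M k) :=
  [/\ forall p, multilinear (a p),
      forall p, alternating (a p) &
      forall p u, smooth_on (F := R^o) (mchart p @` chart_dom (mchart p))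
                            (fun y => local_form a p y u)].

Definition pullback (R : realType) (M N : manifoldType R) (k : nat)
    (f : M -> N) (a : preform N k) : preform M k :=
  fun p u => a (f p) (fun i => tmap f p (u i)).

(* (da)_p(u_0,..,u_k) = sum_i (-1)^i D_(u_i) a(u_0,..,^u_i,..,u_k), computed in
   the chart attached to [p]. *)
Definition ext_d (R : realType) (M : manifoldType R) (k : nat)
    (a : preform M k) : preform M k.+1 :=
  fun p u => \sum_(i < k.+1) (-1) ^+ i *
    'D_(u i) (fun y => local_form a p y (fun j => u (lift i j)) : R^o)
             (mchart p p).

Definition inner_contract (R : realType) (V : lmodType R) (k : nat) (w : V)
    (a : ('I_k.+1 -> V) -> R) : ('I_k -> V) -> R :=
  fun u => a (fun i => if unlift ord0 i is Some j then u j else w).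

Definition form_ker (R : realType) (V : lmodType R) (k : nat)
    (a : ('I_k.+1 -> V) -> R) : set V :=
  [set w | inner_contract w a = fun _ => 0].

(** * Relative forms *)

(* [relform N M k] is Omega^(k+1)(f) for f : M -> N, up to smoothness. *)
Definition relform (R : realType) (N M : manifoldType R) (k : nat) : Type :=
  preform N k.+1 * preform M k.

Definition rel_d (R : realType) (M N : manifoldType R) (k : nat) (f : M -> N)
    (a : relform N M k) : relform N M k.+1 :=
  (ext_d a.1, fun p u => pullback f a.1 p u - ext_d a.2 p u).

Definition rel_closed (R : realType) (M N : manifoldType R) (k : nat)
    (f : M -> N) (a : relform N M k) :=
  rel_d f a = (fun _ _ => 0, fun _ _ => 0).

Definition rel_pre_2plectic (R : realType) (M N : manifoldType R) (f : M -> N)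
    (a : relform N M 2) :=
  [/\ is_form a.1, is_form a.2 & rel_closed f a].

Definition rel_nondegenerate (R : realType) (M N : manifoldType R)
    (f : M -> N) (a : relform N M 2) :=
  forall m : M, injective (fun w : 'rV[R]_(mdim M) =>
    (inner_contract (tmap f m w) (a.1 (f m)), inner_contract w (a.2 m))).

Definition rel_2plectic (R : realType) (M N : manifoldType R) (f : M -> N)
    (a : relform N M 2) :=
  rel_pre_2plectic f a /\ rel_nondegenerate f a.

(** * Lie groups *)

HB.mixin Record isLieGroup (R : realType) G of Manifold R G & Group G := {
  mulg_smooth : smooth_map2 (fun g h : G => (g * h)%g) ;
  invg_smooth : smooth_map (fun g : G => (g^-1)%g) }.

#[short(type="lieGroupType")]
HB.structure Definition LieGroup (R : realType) :=
  { G of isLieGroup R G & Manifold R G & Group G }.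

Definition lconj (R : realType) (G : lieGroupType R) (g h : G) : G :=
  (g * h * g^-1)%g.

Definition Ad (R : realType) (G : lieGroupType R) (g : G)
    : 'rV[R]_(mdim G) -> 'rV[R]_(mdim G) := tmap (lconj g) 1%g.

Definition left_inv_vf (R : realType) (G : lieGroupType R)
    (x : 'rV[R]_(mdim G)) (g : G) : 'rV[R]_(mdim G) :=
  tmap (fun h : G => (g * h)%g) 1%g x.

Definition lie_bracket (R : realType) (G : lieGroupType R)
    (x y : 'rV[R]_(mdim G)) : 'rV[R]_(mdim G) :=
  vf_bracket (left_inv_vf (G := G) x) (left_inv_vf y) 1%g.

Definition thetaL (R : realType) (G : lieGroupType R) (g : G)
    (w : 'rV[R]_(mdim G)) : 'rV[R]_(mdim G) :=
  tmap (fun h : G => (g^-1 * h)%g) g w.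

Definition thetaR (R : realType) (G : lieGroupType R) (g : G)
    (w : 'rV[R]_(mdim G)) : 'rV[R]_(mdim G) :=
  tmap (fun h : G => (h * g^-1)%g) g w.

Definition inner_product (R : realType) (V : lmodType R) (ip : V -> V -> R) :=
  [/\ forall c x y z, ip (c *: x + y) z = c * ip x z + ip y z,
      forall x y, ip x y = ip y x &
      forall x, x != 0 -> 0 < ip x x].

Definition Ad_invariant (R : realType) (G : lieGroupType R)
    (ip : 'rV[R]_(mdim G) -> 'rV[R]_(mdim G) -> R) :=
  forall (g : G) x y, ip (Ad g x) (Ad g y) = ip x y.

(* eta = 1/12 <thetaL, [thetaL, thetaL]>, where both products of Lie algebra
   valued forms are wedge products (without normalisation factors), i.e. sums
   over the (1,1)- and the (1,2)-shuffles respectively. *)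
Definition cartan_form (R : realType) (G : lieGroupType R)
    (ip : 'rV[R]_(mdim G) -> 'rV[R]_(mdim G) -> R) : preform G 3 :=
  fun g u =>
    let th i := thetaL g (u (inord i)) in
    let br i j := lie_bracket (G := G) (th i) (th j)
                  - lie_bracket (G := G) (th j) (th i) in
    12^-1 * (ip (th 0%N) (br 1%N 2%N) - ip (th 1%N) (br 0%N 2%N)
             + ip (th 2%N) (br 0%N 1%N)).

(* The 1-form <thetaL + thetaR, x> on G. *)
Definition theta_sum (R : realType) (G : lieGroupType R)
    (ip : 'rV[R]_(mdim G) -> 'rV[R]_(mdim G) -> R) (x : 'rV[R]_(mdim G))
    : preform G 1 :=
  fun g u => ip (thetaL g (u ord0) + thetaR g (u ord0)) x.

(** * Group actions *)

Definition smooth_action (R : realType) (G : lieGroupType R)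
    (M : manifoldType R) (act : G -> M -> M) :=
  [/\ smooth_map2 act, forall m, act 1%g m = m &
      forall g h m, act (g * h)%g m = act g (act h m)].

Definition invariant_form (R : realType) (G : lieGroupType R)
    (M : manifoldType R) (act : G -> M -> M) (k : nat) (a : preform M k) :=
  forall g : G, pullback (act g) a = a.

(* [c] is the curve t |-> exp(t x). *)
Definition exp_curve (R : realType) (G : lieGroupType R)
    (x : 'rV[R]_(mdim G)) (c : R -> G) :=
  [/\ smooth_curve c, forall s t, c (s + t) = (c s * c t)%g &
      velocity c 0 = x].

(* The graph of x |-> v_x(m), where v_x(m) = d/dt|_(t=0) exp(-t x) . m. *)
Definition fund_vf (R : realType) (G : lieGroupType R)
    (M : manifoldType R) (act : G -> M -> M) (x : 'rV[R]_(mdim G)) (m : M)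
    (v : 'rV[R]_(mdim M)) :=
  exists2 c : R -> G, exp_curve x c &
    v = velocity (fun t => act (c (- t)) m) 0.

(* Main.v *)
(* Write theta for thetaL.  By Ad-invariance <x,[y,z]> is alternating, so
   eta = <theta,[theta,theta]>/2, and by the Maurer-Cartan equation d eta is a
   sum of terms <[a,b],[c,d]> which vanishes by the Jacobi identity.  If w lies
   in the kernel of the nondegeneracy map at m, then (QH3) gives w = v_x(m) with
   Ad_(mu m) x = - x, and theta (T mu w) = x - Ad_(mu m)^-1 x = 2x by
   equivariance; iota_(T mu w) eta = 0 makes 2x orthogonal to [g,g], hence
   central, hence fixed by Ad_(mu m) as G is connected, so x = 0 and w = 0. *)

Require Import Defs.
From HB Require Import structures.
From mathcomp Require Import all_boot all_order all_algebra.
From mathcomp Require Import all_classical all_reals all_analysis.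
From mathcomp Require Import ring lra.

Set Implicit Arguments.
Unset Strict Implicit.
Unset Printing Implicit Defensive.

Import Order.TTheory GRing.Theory Num.Theory.
Import numFieldNormedType.Exports.

Local Open Scope classical_set_scope.
Local Open Scope ring_scope.

(** * Smooth maps between normed spaces *)

Section Calculus.
Variable R : realType.
Implicit Types E F : normedModType R.

(** The tangent space at [p] is the coordinate space of the chart attached to [p], so the
    identification jumps from point to point and no field or form can be differentiated as it
    stands. Everything is therefore first moved into one fixed chart ([chart_diff], [locvf],
    [local_theta]), where it becomes a partial derivative of a map built from multiplication and
    inversion; its smoothness then follows from theirs. The Lie theory integrates no flows. Its
    source is that g |-> Ad_g x has derivative [v,x] at 1 along v, which rests on the symmetry of
    second derivatives. Differentiating Ad_g [a,b] = [Ad_g a, Ad_g b] and <Ad_g x, Ad_g z> = <x,z>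
    at 1 then gives the Jacobi identity and the skew-symmetry of z |-> [v,z]. The latter also
    explains why orthogonality to [g,g] forces centrality: it turns |[v,t]|^2 into
    -<t,[v,[v,t]]>. *)

Lemma diff_near_eq E F (f g : E -> F) (x : E) :
  (\near x, f x = g x) -> differentiable f x -> is_diff x g ('d f x).
Proof.
move=> fg df.
have H : g \o shift x = cst (g x) + 'd f x +o_ 0 id.
  apply/eqaddoP => e e0.
  have /eqaddoP/(_ e e0) := diff_locally df.
  apply: filter_app.
  have : \forall h \near 0, f (h + x) = g (h + x).
    by rewrite (near_shift x 0) /=; apply: filterS fg => y /=; rewrite sub0r addrNK.
  apply: filterS => h fgh; rewrite /= -![(_ - _ : _ -> _) _]/(_ - _) /=.
  by rewrite fgh (nbhs_singleton fg) /=.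
have dE : 'd g x = 'd f x :> (E -> F).
  by apply: diff_unique => //; exact: diff_continuous.
apply: DiffDef => //.
by apply/diff_locallyP; rewrite dE; split => //; exact: diff_continuous.
Qed.

Lemma C_onS E F k (U V : set E) (f : E -> F) :
  V `<=` U -> C_on k U f -> C_on k V f.
Proof.
elim: k f => [|k IH] f VU /=; first by move=> h x /VU /h.
by case=> h1 h2; split=> [x /VU /h1 //|v]; apply: IH.
Qed.

Lemma C_onW E F k (U : set E) (f : E -> F) : C_on k.+1 U f -> C_on k U f.
Proof.
elim: k f => [|k IH] f [h1 h2].
  by move=> x /h1; exact: differentiable_continuous.
by split=> // v; apply: IH.
Qed.

Lemma C_on_ext E F k (U : set E) (f g : E -> F) : open U ->
  (forall x, U x -> f x = g x) -> C_on k U f -> C_on k U g.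
Proof.
move=> oU; have nearU x : U x -> nbhs x U by move=> Ux; exact: open_nbhs_nbhs.
elim: k f g => [|k IH] f g fg /=.
  move=> cf x Ux.
  have fgx : \near x, f x = g x by apply: filterS (nearU _ Ux).
  rewrite /prop_for /continuous_at -(fg _ Ux).
  exact: cvg_trans (near_eq_cvg fgx) (cf x Ux).
case=> df Cf.
have dg x : U x -> is_diff x g ('d f x).
  move=> Ux; apply: diff_near_eq (df _ Ux).
  by apply: filterS (nearU _ Ux).
split=> [x /dg //|v].
apply: IH (Cf v) => x Ux.
by rewrite (@diff_val _ _ _ _ _ _ _ (dg x Ux)).
Qed.

Lemma C_on_cst E F k (U : set E) (a : F) : C_on k U (fun=> a).
Proof.
elim: k a => [|k IH] a /=; first by move=> x _; exact: cst_continuous.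
split=> [x _|v]; first exact: differentiable_cst.
rewrite (_ : (fun x => _) = fun=> 0); first exact: IH.
by apply/funext => x; rewrite (diff_cst a x).
Qed.

Lemma C_on_add E F k (U : set E) (f g : E -> F) : open U ->
  C_on k U f -> C_on k U g -> C_on k U (fun x => f x + g x).
Proof.
move=> oU; elim: k f g => [|k IH] f g /=.
  by move=> cf cg x Ux; apply: continuousD; [exact: cf|exact: cg].
case=> df Cf [dg Cg]; split=> [x Ux|v].
  by apply: (@differentiableD _ _ _ f g); [exact: df|exact: dg].
apply: C_on_ext (IH _ _ (Cf v) (Cg v)) => // x Ux.
by rewrite (@diffD _ _ _ f g) //; [exact: df|exact: dg].
Qed.

Lemma C_on_pair E F (F' : normedModType R) k (U : set E)
    (f : E -> F) (g : E -> F') : open U ->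
  C_on k U f -> C_on k U g -> C_on k U (fun x => (f x, g x)).
Proof.
move=> oU; elim: k f g => [|k IH] f g /=.
  by move=> cf cg x Ux; apply: cvg_pair; [exact: cf|exact: cg].
case=> df Cf [dg Cg]; split=> [x Ux|v].
  by apply: differentiable_pair; [exact: df|exact: dg].
apply: C_on_ext (IH _ _ (Cf v) (Cg v)) => // x Ux.
by rewrite diff_pair //; [exact: df|exact: dg].
Qed.

Lemma C_on_linear E F k (U : set E) (L : {linear E -> F}) :
  continuous L -> C_on k U L.
Proof.
case: k => [|k] cL /=; first by move=> x _; exact: cL.
split=> [x _|v]; first exact: linear_differentiable.
rewrite (_ : (fun x => _) = fun=> L v); first exact: C_on_cst.
by apply/funext => x; rewrite diff_lin.
Qed.

Lemma is_diff_bilinear E (F1 F2 F : normedModType R)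
    (B : {bilinear F1 -> F2 -> F}) (f : E -> F1) (g : E -> F2) (x : E) :
  continuous (fun p => B p.1 p.2) ->
  differentiable f x -> differentiable g x ->
  is_diff x (fun y => B (f y) (g y))
    (fun v => B ('d f x v) (g x) + B (f x) ('d g x v)).
Proof.
move=> cB df dg.
pose h y := (f y, g y).
have dh : differentiable h x by exact: differentiable_pair.
have dB := @differentiable_bilin _ _ _ _ B (h x) cB.
apply: DiffDef; first exact: (differentiable_comp dh dB).
rewrite (diff_comp dh dB) diff_bilin //; apply/funext => v /=.
by rewrite /h (diff_pair df dg) /= addrC.
Qed.

(** The derivative is a sum of the same pairing with one factor differentiated; the other factor is
    needed only to order [k], whence [C_onW]. *)
Lemma C_on_bilinear E (F1 F2 F : normedModType R) k (U : set E)
    (B : {bilinear F1 -> F2 -> F}) (f : E -> F1) (g : E -> F2) :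
  open U -> continuous (fun p => B p.1 p.2) ->
  C_on k U f -> C_on k U g -> C_on k U (fun x => B (f x) (g x)).
Proof.
move=> oU cB; elim: k f g => [|k IH] f g.
  move=> cf cg x Ux.
  apply: (continuous_comp (f := fun x => (f x, g x))
            (g := fun p => B p.1 p.2)); last exact: cB.
  by apply: cvg_pair; [exact: cf|exact: cg].
move=> Cf Cg; have [df Df] := Cf; have [dg Dg] := Cg.
have dB x (Ux : U x) := is_diff_bilinear cB (df x Ux) (dg x Ux).
split=> [x /dB//|v].
have := C_on_add oU (IH _ _ (Df v) (C_onW Cg)) (IH _ _ (C_onW Cf) (Dg v)).
by apply: C_on_ext => // x Ux; rewrite (@diff_val _ _ _ _ _ _ _ (dB x Ux)).
Qed.

(* A named copy of scaling, so that it can carry a bilinear structure. *)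
Definition scaleb F (a : R^o) (v : F) := a *: v.

Lemma scaleb_is_bilinear F : bilinear_for
    (GRing.Scale.Law.clone _ _ *:%R _) (GRing.Scale.Law.clone _ _ *:%R _)
    (@scaleb F).
Proof.
split=> [u'|u] a x y /=; first by rewrite /scaleb scalerDl scalerA.
by rewrite /scaleb scalerDr !scalerA mulrC.
Qed.

HB.instance Definition _ F := bilinear_isBilinear.Build R R^o F F _ _
  (@scaleb F) (@scaleb_is_bilinear F).

Lemma scaleb_continuous F : continuous (fun p : R^o * F => scaleb p.1 p.2).
Proof. by move=> p; exact: scale_continuous. Qed.

Lemma C_on_scale E F k (U : set E) (a : E -> R^o) (f : E -> F) : open U ->
  C_on k U a -> C_on k U f -> C_on k U (fun x => a x *: f x).
Proof. by move=> oU Ca Cf; apply: C_on_bilinear (@scaleb_continuous F) _ _. Qed.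

Lemma C_on_sum E F k (U : set E) (I : Type) (s : seq I) (f : I -> E -> F) :
  open U -> (forall i, C_on k U (f i)) ->
  C_on k U (fun x => \sum_(i <- s) f i x).
Proof.
move=> oU Cf; elim: s => [|i s IH].
  by rewrite (_ : (fun x => _) = fun=> 0); [exact: C_on_cst|
    apply/funext => x; rewrite big_nil].
rewrite (_ : (fun x => _) = fun x => f i x + \sum_(j <- s) f j x).
  exact: C_on_add.
by apply/funext => x; rewrite big_cons.
Qed.

(* [C_on] only differentiates along fixed directions, so the chain rule needs a
   basis of the intermediate space. *)
Definition findim F := exists (n : nat) (e : 'I_n -> F)
  (l : 'I_n -> {linear F -> R^o}),
  (forall i, continuous (l i)) /\ forall v, v = \sum_i l i v *: e i.

Lemma C_on_comp E F (F' : normedModType R) k (U : set E) (V : set F)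
    (f : E -> F) (g : F -> F') : findim F -> open U -> open V ->
  (forall x, U x -> V (f x)) ->
  C_on k U f -> C_on k V g -> C_on k U (g \o f).
Proof.
move=> [n [e [l [cl lE]]]] oU oV UV.
have Cl j i h : C_on j U h -> C_on j U (l i \o h).
  elim: j h => [|j IH] h.
    by move=> ch x Ux; apply: continuous_comp; [exact: ch|exact: cl].
  case=> dh Dh; split=> [x Ux|v].
    by apply: differentiable_comp; [exact: dh|exact: linear_differentiable].
  apply: C_on_ext (IH _ (Dh v)) => // x Ux.
  rewrite diff_comp /=; [|exact: dh|exact: linear_differentiable].
  by rewrite diff_lin.
elim: k g f UV => [|k IH] g f UV.
  move=> cf cg x Ux; apply: continuous_comp; first exact: cf.
  by apply: cg; exact: UV.
move=> Cf; have [df Df] := Cf; move=> [dg Dg].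
split=> [x Ux|v].
  by apply: differentiable_comp; [exact: df|apply: dg; exact: UV].
(* Expanding the moving direction ['d f x v] in the basis leaves derivatives of [g] along the fixed
   vectors [e i], to which the induction hypothesis applies. *)
have H i : C_on k U (fun x => (l i \o (fun x => 'd f x v)) x *:
    ((fun y => 'd g y (e i)) \o f) x).
  apply: C_on_scale => //; first by apply: Cl; exact: Df.
  exact: (IH (fun y => 'd g y (e i)) f UV (C_onW Cf)) (Dg _).
have := C_on_sum (index_enum 'I_n) oU H.
apply: C_on_ext => // x Ux.
rewrite diff_comp /=; [|exact: df|by apply: dg; exact: UV].
rewrite [in RHS](lE ('d f x v)) raddf_sum /=.
by apply: eq_bigr => i _; rewrite linearZ.
Qed.

(** Smoothness on some neighbourhood, so that later statements carry no domains and the shrinking of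
    open sets is done once, in the closure lemmas. *)
Definition smooth_at E F (f : E -> F) (x : E) :=
  exists U, [/\ open U, U x & smooth_on U f].

Lemma smooth_at_near E F (f : E -> F) x : smooth_at f x -> \near x, smooth_at f x.
Proof.
move=> [U [oU Ux fU]]; have : nbhs x U by exact: open_nbhs_nbhs.
by apply: filterS => y Uy; exists U.
Qed.

Lemma smooth_on_smooth_at E F (U : set E) (f : E -> F) x :
  open U -> smooth_on U f -> U x -> smooth_at f x.
Proof. by exists U. Qed.

(** Unfolded to any depth, [C_on] only tests conditions at the points of its set, so it can be
    checked on singletons; [U] may be any set. *)
Lemma smooth_at_smooth_on E F (U : set E) (f : E -> F) :
  (forall x, U x -> smooth_at f x) -> smooth_on U f.
Proof.
move=> fU k; have {fU} : forall x, U x -> C_on k [set x] f.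
  by move=> x /fU [V [_ Vx fV]]; apply: C_onS (fV k) => _ ->.
elim: k f => [|k IH] f fU; first by move=> x Ux; exact: (fU x Ux).
split=> [x /fU [h _]|v]; first exact: h.
by apply: IH => x /fU [_]; exact.
Qed.

Lemma smooth_at_differentiable E F (f : E -> F) x : smooth_at f x -> differentiable f x.
Proof. by move=> [U [_ Ux /(_ 1%N) [+ _]]]; exact. Qed.

Lemma smooth_at_continuous E F (f : E -> F) x : smooth_at f x -> {for x, continuous f}.
Proof. by move=> /smooth_at_differentiable; exact: differentiable_continuous. Qed.

Lemma smooth_at_derive E F (f : E -> F) x v : smooth_at f x -> 'D_v f x = 'd f x v.
Proof. by move=> /smooth_at_differentiable df; rewrite deriveE. Qed.

Lemma smooth_at_diff E F (f : E -> F) x v :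
  smooth_at f x -> smooth_at (fun y => 'd f y v) x.
Proof.
by move=> [U [oU Ux fU]]; exists U; split=> // k; have [_] := fU k.+1; exact.
Qed.

Lemma smooth_at_ext E F (f g : E -> F) x :
  (\near x, f x = g x) -> smooth_at f x -> smooth_at g x.
Proof.
move=> /nbhs_interior fg [U [oU Ux fU]].
exists (U `&` [set y | f y = g y]^°); split.
- by apply: openI => //; exact: open_interior.
- by split => //; exact: nbhs_singleton.
- move=> k; apply: (@C_on_ext _ _ _ _ f) => //.
  + by apply: openI => //; exact: open_interior.
  + by move=> y [_ /interior_subset].
  + by apply: C_onS (fU k) => y [].
Qed.

Lemma diff_near E F (f g : E -> F) x :
  smooth_at f x -> (\near x, f x = g x) -> 'd g x = 'd f x :> (E -> F).
Proof.
move=> /smooth_at_differentiable df fg.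
by rewrite (@diff_val _ _ _ _ _ _ _ (diff_near_eq fg df)).
Qed.

Lemma smooth_at_cst E F (a : F) (x : E) : smooth_at (fun=> a) x.
Proof. by exists setT; split; [exact: openT| |move=> k; exact: C_on_cst]. Qed.

Lemma smooth_at_linear E F (L : {linear E -> F}) x : continuous L -> smooth_at L x.
Proof.
by move=> cL; exists setT; split; [exact: openT| |move=> k; exact: C_on_linear].
Qed.

Lemma smooth_at_id E (x : E) : smooth_at id x.
Proof. by apply: (@smooth_at_linear _ _ idfun) => ?. Qed.

Lemma smooth_at_pair E F (F' : normedModType R) (f : E -> F) (g : E -> F') x :
  smooth_at f x -> smooth_at g x -> smooth_at (fun x => (f x, g x)) x.
Proof.
move=> [U [oU Ux fU]] [V [oV Vx gV]]; have oUV := openI oU oV.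
exists (U `&` V); split => // k.
by apply: C_on_pair => //; [apply: C_onS (fU k)|apply: C_onS (gV k)] => y [].
Qed.

Lemma smooth_at_add E F (f g : E -> F) x :
  smooth_at f x -> smooth_at g x -> smooth_at (fun x => f x + g x) x.
Proof.
move=> [U [oU Ux fU]] [V [oV Vx gV]]; have oUV := openI oU oV.
exists (U `&` V); split => // k.
by apply: C_on_add => //; [apply: C_onS (fU k)|apply: C_onS (gV k)] => y [].
Qed.

Lemma smooth_at_bilinear E (F1 F2 F : normedModType R)
    (B : {bilinear F1 -> F2 -> F}) (f : E -> F1) (g : E -> F2) x :
  continuous (fun p => B p.1 p.2) ->
  smooth_at f x -> smooth_at g x -> smooth_at (fun x => B (f x) (g x)) x.
Proof.
move=> cB [U [oU Ux fU]] [V [oV Vx gV]]; have oUV := openI oU oV.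
exists (U `&` V); split => // k.
by apply: C_on_bilinear => //; [apply: C_onS (fU k)|apply: C_onS (gV k)] => y [].
Qed.

Lemma smooth_at_comp E F (F' : normedModType R) (f : E -> F) (g : F -> F') x :
  findim F -> smooth_at f x -> smooth_at g (f x) -> smooth_at (g \o f) x.
Proof.
move=> fF fx [V [oV Vfx gV]]; have [U [oU Ux fU]] := fx.
have /nbhs_interior nW : nbhs x (f @^-1` V).
  by apply: (smooth_at_continuous fx); exact: open_nbhs_nbhs.
have oW : open (U `&` (f @^-1` V)^°).
  by apply: openI => //; exact: open_interior.
exists (U `&` (f @^-1` V)^°); split => //.
  by split => //; exact: nbhs_singleton nW.
move=> k; apply: (@C_on_comp _ _ _ _ _ V) => //.
- by move=> y [_ /interior_subset].
- by apply: C_onS (fU k) => y [].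
Qed.

Lemma findim_R : findim R^o.
Proof.
exists 1%N, (fun=> 1), (fun=> idfun); split=> [_ x //|v].
by rewrite big_ord1 /= [RHS]mulr1.
Qed.

Lemma findim_rV n : findim 'rV[R]_n.
Proof.
pose c (i : 'I_n) (v : 'rV[R]_n) : R^o := v ord0 i.
have lc i : linear (c i) by move=> a u v; rewrite /c !mxE.
pose l i : {linear 'rV[R]_n -> R^o} :=
  HB.pack (c i) (GRing.isLinear.Build _ _ _ _ _ (lc i)).
exists n, (fun i => delta_mx ord0 i), l; split=> [i|v].
  exact: coord_continuous.
by rewrite [LHS]row_sum_delta.
Qed.

Lemma findim_prod E F : findim E -> findim F -> findim (E * F)%type.
Proof.
move=> [n [e [l [cl lE]]]] [m [e' [l' [cl' lE']]]].
pose e2 (i : 'I_(n + m)) : E * F :=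
  match fintype.split i with inl j => (e j, 0) | inr j => (0, e' j) end.
pose c (i : 'I_(n + m)) (p : E * F) : R^o :=
  match fintype.split i with inl j => l j p.1 | inr j => l' j p.2 end.
have lc i : linear (c i).
  by move=> a u v; rewrite /c; case: (fintype.split i) => j /=; rewrite linearP.
pose l2 i : {linear (E * F)%type -> R^o} :=
  HB.pack (c i) (GRing.isLinear.Build _ _ _ _ _ (lc i)).
exists (n + m)%N, e2, l2; split=> [i p|[u v]].
  rewrite /l2 /= /c; case: (fintype.split i) => j.
    by apply: continuous_comp; [exact: cvg_fst|exact: cl].
  by apply: continuous_comp; [exact: cvg_snd|exact: cl'].
rewrite big_split_ord /= /c /e2.
under eq_bigr => i _ do rewrite (unsplitK (inl i : 'I_n + 'I_m)) /=.
under [X in _ + X]eq_bigr => i _ do rewrite (unsplitK (inr i : 'I_n + 'I_m)) /=.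
have s1 : \sum_i l i u *: (e i, 0 : F) = (u, 0).
  rewrite [in RHS](lE u).
  rewrite (big_morph (fun z : E => (z, 0 : F)) (id1 := 0) (op1 := +%R)) //=.
    by apply: eq_bigr => i _; congr pair; rewrite scaler0.
  by move=> a b; congr pair; rewrite addr0.
have s2 : \sum_i l' i v *: (0 : E, e' i) = (0, v).
  rewrite [in RHS](lE' v).
  rewrite (big_morph (fun z : F => (0 : E, z)) (id1 := 0) (op1 := +%R)) //=.
    by apply: eq_bigr => i _; congr pair; rewrite scaler0.
  by move=> a b; congr pair; rewrite addr0.
by rewrite s1 s2; congr pair; rewrite ?addr0 ?add0r.
Qed.

Lemma linear_rV_continuous n F (L : {linear 'rV[R]_n -> F}) : continuous L.
Proof.
move=> x; have -> : (L : _ -> _) =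
    \sum_(i < n) (fun v : 'rV[R]_n => (v ord0 i : R^o) *: L (delta_mx ord0 i)).
  apply/funext => v; rewrite fct_sumE [v in LHS]row_sum_delta raddf_sum /=.
  by apply: eq_bigr => i _; rewrite linearZ.
apply: (@big_ind _ (fun f : 'rV[R]_n -> F => {for x, continuous f})).
- exact: cst_continuous.
- by move=> f g cf cg; apply: continuousD.
- move=> i _; apply: (continuous_comp (g := fun a : R^o => a *: _)).
    exact: coord_continuous.
  exact: scalel_continuous.
Qed.

Lemma diff_id E (f : E -> E) x : (\near x, f x = x) -> 'd f x = id :> (E -> E).
Proof.
move=> fx; have dI := is_diff_id x.
rewrite (@diff_near _ _ id f x) //.
- exact: (@diff_val _ _ _ _ _ _ _ dI).
- by apply: (@smooth_at_linear _ _ idfun) => ?.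
- by apply: filterS fx => y ->.
Qed.

(** * Mean value theorem and symmetry of second derivatives *)

Definition D2 E F (f : E -> F) x u v := 'd (fun y => 'd f y v) x u.

Lemma mean_value_line E (f : E -> R^o) (y v : E) (s : R) : 0 < s ->
  (forall t, t \in `[0, s] -> differentiable f (y + t *: v)) ->
  exists2 c, c \in `[0, s] & f (y + s *: v) - f y = s * 'd f (y + c *: v) v.
Proof.
move=> s0 df.
pose g (t : R) : R := f (y + t *: v).
have dline (t : R) :
    is_diff t ((fun t : R^o => y + t *: v) : R^o -> E) ( *:%R^~ v).
  by apply: is_diff_eq (is_diffD (is_diff_cst y t) (is_diff_scalel t v)) _;
    rewrite add0r.
have dg t : t \in `[0, s] -> is_derive t 1 g ('d f (y + t *: v) v).
  move=> /df dft.
  have dgt : is_diff t (g : R^o -> R^o) ('d f (y + t *: v) \o *:%R^~ v).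
    exact: (@is_diff_comp _ _ _ _ _ _ f _ t (dline t) (differentiableP dft)).
  have dgt' : differentiable (g : R^o -> R^o) t by exact: (@ex_diff _ _ _ _ _ _ _ dgt).
  split; first exact: diff_derivable dgt'.
  by rewrite (deriveE _ dgt') (@diff_val _ _ _ _ _ _ _ dgt) /= scale1r.
pose dgf (t : R) : R := 'd f (y + t *: v) v.
have dg' t : t \in `]0, s[ -> is_derive t 1 g (dgf t).
  by move=> ts; apply: dg; exact: subset_itv_oo_cc ts.
have cg : {within `[0, s], continuous g}.
  apply: derivable_within_continuous => t ts.
  exact: (@ex_derive _ _ _ _ _ _ _ (dg t ts)).
have [c cs gc] := @MVT_segment R g dgf 0 s (ltW s0) dg' cg.
exists c => //; move: gc; rewrite /g scale0r addr0 subr0 => ->.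
by rewrite [LHS]mulrC.
Qed.

(** The mean value theorem is applied twice: to y |-> f (y + s v) - f y along [u], then along [v] to
    the derivative of [f] in the direction [u]. *)
Lemma mean_value_square E (f : E -> R^o) (x u v : E) (s : R) : 0 < s ->
  (forall a b, a \in `[0, s] -> b \in `[0, s] -> smooth_at f (x + a *: u + b *: v)) ->
  exists a b, [/\ a \in `[0, s], b \in `[0, s] &
    f (x + s *: u + s *: v) - f (x + s *: u) - (f (x + s *: v) - f x) =
    s * (s * D2 f (x + a *: u + b *: v) v u)].
Proof.
move=> s0 smf.
have I0 : 0 \in `[0, s] by rewrite in_itv /= lexx ltW.
have Is : s \in `[0, s] by rewrite in_itv /= lexx ltW.
pose w := s *: v.
have dsh (y : E) : is_diff y (fun z => z + w) id.
  by apply: is_diff_eq (is_diffD (is_diff_id y) (is_diff_cst w y)) _; rewrite addr0.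
pose h (y : E) : R^o := f (y + w) - f y.
have dh t : t \in `[0, s] -> is_diff (x + t *: u) h
   (fun z => 'd f (x + t *: u + w) z - 'd f (x + t *: u) z).
  move=> ts.
  have d1 : differentiable f (x + t *: u + w).
    by apply: smooth_at_differentiable; apply: smf.
  have d0 : differentiable f (x + t *: u).
    by apply: smooth_at_differentiable; have := smf _ _ ts I0; rewrite scale0r addr0.
  have d2 := @is_diff_comp _ _ _ _ _ _ f _ _ (dsh (x + t *: u)) (differentiableP d1).
  exact: is_diff_eq (is_diffB d2 (differentiableP d0)) _.
have [a as_ ha] : exists2 c, c \in `[0, s] &
    h (x + s *: u) - h x = s * 'd h (x + c *: u) u.
  apply: mean_value_line => // t /dh dht.
  exact: (@ex_diff _ _ _ _ _ _ _ dht).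
have [b bs hb] : exists2 c, c \in `[0, s] &
    'd f (x + a *: u + s *: v) u - 'd f (x + a *: u) u =
    s * 'd (fun y => 'd f y u) (x + a *: u + c *: v) v.
  apply: (@mean_value_line _ (fun y => 'd f y u)) => // t ts.
  by apply: smooth_at_differentiable; apply: smooth_at_diff; exact: smf.
exists a, b; split => //.
by move: ha; rewrite (@diff_val _ _ _ _ _ _ _ (dh a as_)) /D2 -hb.
Qed.

(** The second difference of [f] over the square spanned by s u and s v does not change when [u] and
    [v] are exchanged, so the two mixed derivatives agree at suitable points close to [x].
    Continuity puts each within half of the supposed gap, a contradiction. *)
Lemma D2_sym_scalar E (f : E -> R^o) x u v : smooth_at f x -> D2 f x u v = D2 f x v u.
Proof.
move=> smf; apply/eqP/negPn/negP => neq.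
pose eps := `|D2 f x u v - D2 f x v u| / 2.
have eps0 : 0 < eps by rewrite divr_gt0 // normr_gt0 subr_eq0.
have cD a b : {for x, continuous (fun y => D2 f y a b : R^o)}.
  by apply: smooth_at_continuous; apply: (smooth_at_diff a (smooth_at_diff b smf)).
have near_eps a b : \forall y \near x, `|D2 f x a b - D2 f y a b| < eps.
  by have /cvgrPdist_lt := cD a b; exact.
have /nbhs_ballP[r /= r0 xr] :
    \forall y \near x, [/\ smooth_at f y, `|D2 f x u v - D2 f y u v| < eps &
                          `|D2 f x v u - D2 f y v u| < eps].
  near=> y; split; near: y; [exact: smooth_at_near|exact: near_eps|exact: near_eps].
(* This side length keeps the whole square inside the ball of radius [r]; the summand 1 makes the
   denominator positive even for u = v = 0. *)
pose s := r / (`|u| + `|v| + 1).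
have uv1 : 0 < `|u| + `|v| + 1 by rewrite ltr_wpDl // addr_ge0.
have s0 : 0 < s by rewrite divr_gt0.
have inb a b w z : `|w| + `|z| = `|u| + `|v| -> a \in `[0, s] -> b \in `[0, s] ->
    ball x r (x + a *: w + b *: z).
  rewrite !in_itv /= => wz /andP[a0 a1] /andP[b0 b1].
  rewrite -ball_normE /= -addrA opprD addNKr normrN.
  rewrite (le_lt_trans (ler_normD _ _)) // !normrZ !ger0_norm //.
  apply: (@le_lt_trans _ _ (s * (`|u| + `|v|))).
    by rewrite -wz mulrDr lerD // ler_wpM2r.
  by rewrite /s -mulrA gtr_pMr // mulrC ltr_pdivrMr // mul1r ltrDl.
have [a [b [a0 b0 Dab]]] := mean_value_square s0
  (fun a b ha hb => let: And3 h _ _ := xr _ (inb a b u v erefl ha hb) in h).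
have [a' [b' [a0' b0' Dab']]] := mean_value_square s0
  (fun a b ha hb => let: And3 h _ _ := xr _ (inb a b v u (addrC _ _) ha hb) in h).
have [_ _ h1] := xr _ (inb a b u v erefl a0 b0).
have [_ h2 _] := xr _ (inb a' b' v u (addrC _ _) a0' b0').
have e12 : D2 f (x + a *: u + b *: v) v u = D2 f (x + a' *: v + b' *: u) u v.
  apply: (mulfI (lt0r_neq0 s0)); apply: (mulfI (lt0r_neq0 s0)).
  rewrite -Dab -Dab' -!addrA [s *: u + s *: v]addrC.
  rewrite !opprD !opprK; congr (_ + _).
  by rewrite addrCA.
have : `|D2 f x u v - D2 f x v u| < eps + eps.
  rewrite -[D2 f x u v](subrK (D2 f (x + a' *: v + b' *: u) u v)) -addrA -e12.
  rewrite (le_lt_trans (ler_normD _ _)) // ltrD //; first by rewrite e12.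
  by rewrite distrC.
by rewrite -splitr ltxx.
Unshelve. all: by end_near. Qed.

(** Continuous linear coordinates commute with differentiation, which reduces the claim to scalar
    functions. *)
Lemma D2_sym E F (f : E -> F) x u v : findim F -> smooth_at f x ->
  D2 f x u v = D2 f x v u.
Proof.
move=> [n [e [l [cl lE]]]] smf.
have fF : findim F by exists n, e, l.
have dl i a b : l i (D2 f x a b) = D2 (l i \o f) x a b.
  have smc (y : F) : smooth_at (l i) y by exact: smooth_at_linear.
  rewrite {2}/D2 (@diff_near _ _ (l i \o (fun y => 'd f y b))).
  - have d1 := smooth_at_differentiable (smooth_at_diff b smf).
    have d2 := smooth_at_differentiable (smc ('d f x b)).
    by rewrite (diff_comp d1 d2) /= (diff_lin _ (cl i)).
  - by apply: smooth_at_comp => //; exact: smooth_at_diff.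
  - have := smooth_at_near smf; apply: filterS => y smy /=.
    have d1 := smooth_at_differentiable smy.
    have d2 := smooth_at_differentiable (smc (f y)).
    by rewrite (diff_comp d1 d2) /= (diff_lin _ (cl i)).
rewrite (lE (D2 f x u v)) (lE (D2 f x v u)); apply: eq_bigr => i _.
congr (_ *: _); rewrite !dl; apply: D2_sym_scalar.
by apply: smooth_at_comp => //; exact: smooth_at_linear.
Qed.

(** A ball contains the segment from its centre to [y], on which the mean value theorem is applied
    to each coordinate of [f]. Serves to show that g |-> Ad_g x is locally constant for central
    x. *)
Lemma diff0_ball_cst E F (f : E -> F) x y (r : R) : findim F ->
  (forall z, ball x r z -> differentiable f z /\ forall v, 'd f z v = 0) ->
  ball x r y -> f y = f x.
Proof.
move=> [n [e [l [cl lE]]]] df xy.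
rewrite (lE (f y)) (lE (f x)); apply: eq_bigr => i _; congr (_ *: _).
have inb t : t \in `[0, 1] -> ball x r (x + t *: (y - x)).
  rewrite in_itv /= => /andP[t0 t1]; move: xy; rewrite -!ball_normE /=.
  rewrite opprD addNKr normrN normrZ ger0_norm // distrC => xy.
  by rewrite (le_lt_trans _ xy) // ler_piMl.
have dl z : ball x r z -> is_diff z (l i \o f) (fun=> 0).
  move=> /df [dfz df0]; have lz := linear_differentiable (f z) (cl i).
  apply: DiffDef; first exact: differentiable_comp.
  rewrite (diff_comp dfz lz) (diff_lin _ (cl i)).
  by apply/funext => v /=; rewrite df0 linear0.
have [t /inb/dl dt ft] : exists2 c, c \in `[0, 1] &
    (l i \o f) (x + 1 *: (y - x)) - (l i \o f) x =
    1 * 'd (l i \o f) (x + c *: (y - x)) (y - x).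
  apply: mean_value_line => // t /inb/dl dt.
  exact: (@ex_diff _ _ _ _ _ _ _ dt).
move: ft; rewrite (@diff_val _ _ _ _ _ _ _ dt) mulr0 scale1r [x + _]addrC subrK /=.
by move/eqP; rewrite subr_eq0 => /eqP.
Qed.

Lemma is_diff_sum E F x n (f df : 'I_n -> E -> F) :
  (forall i, is_diff x (f i) (df i)) ->
  is_diff x (fun y => \sum_i f i y) (fun v => \sum_i df i v).
Proof.
move=> fdf; pose S (g : 'I_n -> E -> F) := \sum_i g i.
have SE g : (fun y => \sum_i g i y) = S g.
  by apply/funext => y; rewrite /S fct_sumE.
rewrite !SE /S; elim/big_ind2: _ => //; first exact: is_diff_cst.
by move=> *; exact: is_diffD.
Qed.

Lemma is_diff_linear_comp E F (F' : normedModType R) (L : {linear F -> F'})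
    (f : E -> F) x : continuous L -> differentiable f x ->
  is_diff x (L \o f) (L \o 'd f x).
Proof.
move=> cL df; have dL := linear_differentiable (f x) cL.
have := is_diff_comp (differentiableP df) (differentiableP dL).
by rewrite (diff_lin _ cL).
Qed.

(** * Product rules for linear maps that depend on a point *)

Section Apply.
Variables (E F F' : normedModType R) (A : E -> {linear F -> F'}) (Z : E -> F).
Variable (x : E).
Hypotheses (fF : findim F) (smA : forall v, smooth_at (fun y => A y v) x).
Hypothesis (smZ : smooth_at Z x).

(** [A] is smooth only against fixed vectors. Expanding [Z y] in a basis leaves scalar functions
    times [A y (e i)], so that no norm on a space of linear maps is needed. *)
Lemma smooth_at_apply : smooth_at (fun y => A y (Z y)) x.
Proof.
have [n [e [l [cl lE]]]] := fF.
have smlZ i : smooth_at (l i \o Z) x.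
  by apply: smooth_at_comp => //; exact: smooth_at_linear.
have -> : (fun y => A y (Z y)) =
    (fun y => \sum_i scaleb (l i (Z y)) (A y (e i))).
  apply/funext => y; rewrite [in LHS](lE (Z y)) raddf_sum /=.
  by apply: eq_bigr => i _; rewrite linearZ.
elim: (index_enum _) => [|i s IH].
  by under eq_fun do rewrite big_nil; exact: smooth_at_cst.
under eq_fun do rewrite big_cons.
apply: smooth_at_add IH.
by apply: (smooth_at_bilinear (@scaleb_continuous F') (smlZ i)).
Qed.

Lemma is_diff_apply : is_diff x (fun y => A y (Z y))
  (fun v => 'd (fun y => A y (Z x)) x v + A x ('d Z x v)).
Proof.
have [n [e [l [cl lE]]]] := fF.
have dA v := differentiableP (smooth_at_differentiable (smA v)).
have AE y v : A y v = \sum_i l i v *: A y (e i).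
  rewrite [in LHS](lE v) raddf_sum /=.
  by apply: eq_bigr => i _; rewrite linearZ.
have dh i : is_diff x (fun y => scaleb (l i (Z y)) (A y (e i)))
    (fun v => scaleb (l i ('d Z x v)) (A x (e i)) +
              scaleb (l i (Z x)) ('d (fun y => A y (e i)) x v)).
  have dlZ := is_diff_linear_comp (cl i) (smooth_at_differentiable smZ).
  have := is_diff_bilinear (@scaleb_continuous F')
    (@ex_diff _ _ _ _ _ _ _ dlZ) (smooth_at_differentiable (smA (e i))).
  by rewrite (@diff_val _ _ _ _ _ _ _ dlZ).
have := is_diff_sum dh.
rewrite (_ : (fun y => \sum_i _) = (fun y => A y (Z y))); last first.
  by apply/funext => y; rewrite [in RHS]AE.
move/is_diff_eq; apply; apply/funext => v.
rewrite big_split /= addrC; congr (_ + _); last by rewrite [in RHS]AE.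
have dc i := is_diffZ (l i (Z x)) (dA (e i)).
have := is_diff_sum dc.
rewrite (_ : (fun y => \sum_i _) = (fun y => A y (Z x))); last first.
  by apply/funext => y; rewrite [in RHS]AE.
by move=> h; rewrite (@diff_val _ _ _ _ _ _ _ h).
Qed.

End Apply.

Section Bilinear.
Variables (E F : normedModType R) (n m : nat).
Variables (B : 'rV[R]_n -> 'rV[R]_m -> F).
Hypotheses (Br : forall u, linear (B u)) (Bl : forall v, linear (B^~ v)).
Variables (f : E -> 'rV[R]_n) (g : E -> 'rV[R]_m) (x : E).
Hypotheses (smf : smooth_at f x) (smg : smooth_at g x).

Let Ar u : {linear 'rV[R]_m -> F} :=
  HB.pack (B u) (GRing.isLinear.Build _ _ _ _ _ (Br u)).
Let Al v : {linear 'rV[R]_n -> F} :=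
  HB.pack (B^~ v) (GRing.isLinear.Build _ _ _ _ _ (Bl v)).

Let smAr v : smooth_at (fun y => Ar (f y) v) x.
Proof.
apply: (@smooth_at_comp _ _ _ f (Al v)) => //; first exact: findim_rV.
by apply: smooth_at_linear; exact: linear_rV_continuous.
Qed.

(** The case of the linear maps [B (f y)]. [B] is a bare function with linearity proofs because
    [lie_bracket] and [half_ip] come in that form. *)
Lemma smooth_at_rV_bilinear : smooth_at (fun y => B (f y) (g y)) x.
Proof. exact: (smooth_at_apply (@findim_rV m) smAr smg). Qed.

Lemma diff_rV_bilinear v :
  'd (fun y => B (f y) (g y)) x v = B ('d f x v) (g x) + B (f x) ('d g x v).
Proof.
have dB := is_diff_apply (@findim_rV m) smAr smg.
have dl := is_diff_linear_comp (@linear_rV_continuous _ _ (Al (g x)))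
  (smooth_at_differentiable smf).
have := congr1 (fun h => h v) (@diff_val _ _ _ _ _ _ _ dB).
by have -> := congr1 (fun h => h v) (@diff_val _ _ _ _ _ _ _ dl).
Qed.

End Bilinear.

(** * Partial derivatives of a function of two variables *)

Section Partial.
Variables (E1 E2 F : normedModType R) (f : E1 * E2 -> F).

Lemma is_diff_pairr (a : E1) (z : E2) :
  is_diff z (fun z => (a, z)) (fun v => (0, v)).
Proof. exact: is_diff_pair (is_diff_cst a z) (is_diff_id z). Qed.

Lemma is_diff_pairl (a : E2) (y : E1) :
  is_diff y (fun y => (y, a)) (fun v => (v, 0)).
Proof. exact: is_diff_pair (is_diff_id y) (is_diff_cst a y). Qed.

Lemma diff_partial2 y z v : smooth_at f (y, z) ->
  'd (fun z => f (y, z)) z v = 'd f (y, z) (0, v).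
Proof.
move=> /smooth_at_differentiable/differentiableP df.
have h := @is_diff_comp _ _ _ _ _ _ f _ _ (is_diff_pairr y z) df.
exact: (congr1 (fun h => h v) (@diff_val _ _ _ _ _ _ _ h)).
Qed.

Lemma diff_partial1 y z v : smooth_at f (y, z) ->
  'd (fun y => f (y, z)) y v = 'd f (y, z) (v, 0).
Proof.
move=> /smooth_at_differentiable/differentiableP df.
have h := @is_diff_comp _ _ _ _ _ _ f _ _ (is_diff_pairl z y) df.
exact: (congr1 (fun h => h v) (@diff_val _ _ _ _ _ _ _ h)).
Qed.

Hypotheses (fE1 : findim E1) (fE2 : findim E2).

(** The partial derivative is the full one in the direction (0, v), composed with y |-> (y, Z y). A
    moving base point is allowed because the Maurer-Cartan form differentiates h |-> g^-1 h at g
    itself; left-invariant fields and Ad use a constant [Z]. *)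
Lemma smooth_at_partial2 (Z : E1 -> E2) y v : smooth_at Z y -> smooth_at f (y, Z y) ->
  smooth_at (fun y => 'd (fun z => f (y, z)) (Z y) v) y.
Proof.
move=> smZ smf; have smYZ := smooth_at_pair (smooth_at_id y) smZ.
have fE := findim_prod fE1 fE2.
apply: (@smooth_at_ext _ _ ((fun p => 'd f p (0, v)) \o (fun y => (y, Z y)))).
  have : \forall y \near y, smooth_at f (y, Z y).
    exact: (smooth_at_continuous smYZ (smooth_at_near smf)).
  by apply: filterS => y' smf'; rewrite diff_partial2.
exact: (smooth_at_comp fE smYZ (smooth_at_diff (0, v) smf)).
Qed.

(** Both sides are second derivatives of [f] on the product space in the directions (v, 0) and (0,
    w), taken in opposite orders. *)
Lemma mixed_partials y z v w : findim F -> smooth_at f (y, z) ->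
  'd (fun y => 'd (fun z => f (y, z)) z w) y v =
  'd (fun z => 'd (fun y => f (y, z)) y v) z w.
Proof.
move=> fF smf; have fE := findim_prod fE1 fE2.
have sm1 : smooth_at (fun y => (y, z)) y.
  exact: smooth_at_pair (smooth_at_id y) (smooth_at_cst z y).
have sm2 : smooth_at (fun z => (y, z)) z.
  exact: smooth_at_pair (smooth_at_cst y z) (smooth_at_id z).
have n1 : \forall y \near y, smooth_at f (y, z) :=
  smooth_at_continuous sm1 (smooth_at_near smf).
have n2 : \forall z \near z, smooth_at f (y, z) :=
  smooth_at_continuous sm2 (smooth_at_near smf).
have e1 : 'd (fun y => 'd (fun z => f (y, z)) z w) y v = D2 f (y, z) (v, 0) (0, w).
  rewrite (@diff_near _ _ ((fun p => 'd f p (0, w)) \o (fun y => (y, z)))).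
  - have df := differentiableP (smooth_at_differentiable (smooth_at_diff (0, w) smf)).
    have h := is_diff_comp (is_diff_pairl z y) df.
    exact: (congr1 (fun h => h v) (@diff_val _ _ _ _ _ _ _ h)).
  - exact: (smooth_at_comp fE sm1 (smooth_at_diff (0, w) smf)).
  - by apply: filterS n1 => y' smf'; rewrite diff_partial2.
have e2 : 'd (fun z => 'd (fun y => f (y, z)) y v) z w = D2 f (y, z) (0, w) (v, 0).
  rewrite (@diff_near _ _ ((fun p => 'd f p (v, 0)) \o (fun z => (y, z)))).
  - have df := differentiableP (smooth_at_differentiable (smooth_at_diff (v, 0) smf)).
    have h := is_diff_comp (is_diff_pairr y z) df.
    exact: (congr1 (fun h => h w) (@diff_val _ _ _ _ _ _ _ h)).
  - exact: (smooth_at_comp fE sm2 (smooth_at_diff (v, 0) smf)).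
  - by apply: filterS n2 => y' smf'; rewrite diff_partial1.
by rewrite e1 e2; exact: D2_sym.
Qed.

End Partial.

Lemma smooth_at_partial2_rV n m F (f : 'rV[R]_n * 'rV[R]_m -> F) y z v :
  smooth_at f (y, z) -> smooth_at (fun y => 'd (fun z => f (y, z)) z v) y.
Proof.
exact: (@smooth_at_partial2 _ _ _ f (@findim_rV n) (@findim_rV m) (fun=> z) y v
  (smooth_at_cst z y)).
Qed.

End Calculus.

(** * Smooth maps and vector fields on manifolds *)

Section Manifolds.
Variable R : realType.
Implicit Types (E F : normedModType R) (M N P : manifoldType R).

Lemma mchartK M (p q : M) :
  chart_dom (mchart p) q -> chart_inv (mchart p) (mchart p q) = q.
Proof. by move=> pq; apply: chart_mapK; exact: mem_set. Qed.

Lemma mchart_self M (p : M) : chart_dom (mchart p) p.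
Proof. exact: manifold_mem. Qed.

Lemma mchart_selfK M (p : M) : chart_inv (mchart p) (mchart p p) = p.
Proof. exact/mchartK/mchart_self. Qed.

Lemma near_dom M (p q : M) :
  chart_dom (mchart p) q -> \forall z \near q, chart_dom (mchart p) z.
Proof. by move=> pq; apply: open_nbhs_nbhs; split=> //; exact: chart_dom_open. Qed.

Lemma mchart_inv_continuous M (p q : M) : chart_dom (mchart p) q ->
  {for mchart p q, continuous (chart_inv (mchart p))}.
Proof. by move=> pq; apply: chart_inv_continuous; exists q. Qed.

Lemma near_img M (p q : M) : chart_dom (mchart p) q ->
  \forall y \near mchart p q, (mchart p @` chart_dom (mchart p)) y.
Proof.
move=> pq; apply: open_nbhs_nbhs; split; first exact: chart_img_open.
by exists q.
Qed.

Lemma near_chart_inv M (p q : M) (A : set M) : chart_dom (mchart p) q ->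
  (\near q, A q) -> \forall y \near mchart p q, A (chart_inv (mchart p) y).
Proof.
move=> pq Aq; apply: (mchart_inv_continuous pq).
by rewrite mchartK.
Qed.

Lemma open_chart_image M (p : M) (A : set M) : open A ->
  open (mchart p @` (chart_dom (mchart p) `&` A)).
Proof.
move=> oA; rewrite openE => _ [q [pq Aq] <-].
have nA : \near q, A q by apply: open_nbhs_nbhs.
have := near_chart_inv pq nA; have := near_img pq.
apply: filterS2 => _ [z pz <-]; rewrite mchartK // => Az.
by exists z.
Qed.

(** With a normed space as source this covers curves (E = R^o) as well as maps of manifolds read
    through a [chart_inv], also in several variables. *)
Definition msmooth_at E N (f : E -> N) (x : E) := {for x, continuous f} /\
  forall b, chart_dom (mchart b) (f x) -> smooth_at (mchart b \o f) x.

Lemma msmooth_at_near E N (f : E -> N) (x : E) (A : set N) : {for x, continuous f} ->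
  open A -> A (f x) -> \forall y \near x, A (f y).
Proof. by move=> cf oA Afx; apply: cf; exact: open_nbhs_nbhs. Qed.

Lemma msmooth_at_dom E N (f : E -> N) (x : E) (b : N) : msmooth_at f x ->
  chart_dom (mchart b) (f x) -> \forall y \near x, chart_dom (mchart b) (f y).
Proof. by move=> [cf _] bf; apply: msmooth_at_near => //; exact: chart_dom_open. Qed.

(** One chart of the target suffices, because the transition maps are smooth. *)
Lemma msmooth_at_intro E N (f : E -> N) (x : E) (b : N) : {for x, continuous f} ->
  chart_dom (mchart b) (f x) -> smooth_at (mchart b \o f) x -> msmooth_at f x.
Proof.
move=> cf bf smf; split=> // c cfx.
have dombc : \forall y \near x, chart_dom (mchart b) (f y).
  by apply: msmooth_at_near => //; exact: chart_dom_open.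
pose T := mchart c \o chart_inv (mchart b).
have smT : smooth_at T (mchart b (f x)).
  apply: smooth_on_smooth_at (manifold_compat b c) _; last by exists (f x).
  by apply: open_chart_image; exact: chart_dom_open.
apply: (@smooth_at_ext _ _ _ (T \o (mchart b \o f))).
  by apply: filterS dombc => y bfy; rewrite /T /= mchartK.
by apply: smooth_at_comp => //; exact: findim_rV.
Qed.

Lemma msmooth_at_chart_inv M (p q : M) : chart_dom (mchart p) q ->
  msmooth_at (chart_inv (mchart p)) (mchart p q).
Proof.
move=> pq; apply: (@msmooth_at_intro _ _ _ _ p).
- exact: mchart_inv_continuous.
- by rewrite mchartK.
- apply: (@smooth_at_ext _ _ _ idfun); last by apply: smooth_at_linear => ?.
  by apply: filterS (near_img pq) => _ [z pz <-] /=; rewrite mchartK.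
Qed.

Lemma msmooth_at_cst E N (b : N) (x : E) : msmooth_at (fun=> b) x.
Proof. by split=> [|c _]; [exact: cst_continuous|exact: smooth_at_cst]. Qed.

Lemma msmooth_at_map E M N (f : M -> N) (g : E -> M) (x : E) :
  smooth_map f -> msmooth_at g x -> msmooth_at (f \o g) x.
Proof.
move=> [cf smf] smg; have [cg _] := smg.
have a_ := mchart_self (g x); have b_ := mchart_self (f (g x)).
pose a := g x; pose b := f (g x).
apply: (@msmooth_at_intro _ _ _ _ b) => //.
  by apply: continuous_comp => //; exact: cf.
apply: (@smooth_at_ext _ _ _
  ((mchart b \o f \o chart_inv (mchart a)) \o (mchart a \o g))).
  by apply: filterS (msmooth_at_dom smg a_) => y agy /=; rewrite mchartK.
apply: smooth_at_comp; [exact: findim_rV|exact: smg.2|].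
apply: smooth_on_smooth_at (smf a b) _; last by exists (g x).
apply: open_chart_image; apply: open_comp; last exact: chart_dom_open.
by move=> y _; exact: cf.
Qed.

Lemma msmooth_at_comp E F N (g : E -> F) (f : F -> N) (x : E) : findim F ->
  smooth_at g x -> msmooth_at f (g x) -> msmooth_at (f \o g) x.
Proof.
move=> fF smg [cf smf]; split.
  by apply: continuous_comp => //; exact: smooth_at_continuous.
by move=> b /smf smbf; exact: (smooth_at_comp fF smg smbf).
Qed.

Lemma msmooth_at_map2 E M N P (f : M -> N -> P) (g : E -> M) (h : E -> N) (x : E) :
  smooth_map2 f -> msmooth_at g x -> msmooth_at h x ->
  msmooth_at (fun y => f (g y) (h y)) x.
Proof.
move=> [cf smf] smg smh; have [cg _] := smg; have [ch _] := smh.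
pose a := g x; pose b := h x; pose c := f a b.
have a_ : chart_dom (mchart a) a := mchart_self _.
have b_ : chart_dom (mchart b) b := mchart_self _.
have c_ : chart_dom (mchart c) c := mchart_self _.
have cfgh : {for x, continuous (fun y => f (g y) (h y))}.
  apply: (@continuous_comp _ _ _ (fun y => (g y, h y)) (fun z => f z.1 z.2)).
    by apply: cvg_pair; [exact: cg|exact: ch].
  exact: cf.
apply: (@msmooth_at_intro _ _ _ _ c) => //.
pose L (y : 'rV[R]_(mdim M) * 'rV[R]_(mdim N)) :=
  mchart c (f (chart_inv (mchart a) y.1) (chart_inv (mchart b) y.2)).
apply: (@smooth_at_ext _ _ _ (L \o (fun y => (mchart a (g y), mchart b (h y))))).
  apply: filterS2 (msmooth_at_dom smg a_) (msmooth_at_dom smh b_) => y ay bny.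
  by rewrite /L /= !mchartK.
apply: smooth_at_comp.
- by apply: findim_prod; exact: findim_rV.
- by apply: smooth_at_pair; [exact: smg.2|exact: smh.2].
- apply: smooth_on_smooth_at (smf a b c) _; last by exists a, b.
  (* The domain prescribed by [smooth_map2] is open: continuity of [f] on the product yields a box A
     x B, and its image under the two charts is a neighbourhood. *)
  rewrite openE => _ [a' [b' [aa' bb' cf' ->]]].
  have nf : \forall z \near (a', b'), chart_dom (mchart c) (f z.1 z.2).
    by apply: (cf (a', b')); apply: near_dom.
  have [[A B] /= [nA nB] AB] := nf.
  exists (mchart a @` (chart_dom (mchart a) `&` A),
          mchart b @` (chart_dom (mchart b) `&` B)).
    split => /=.
      apply: filterS2 (near_img aa') (near_chart_inv aa' nA) => _ [z az <-].
      by rewrite mchartK // => Az; exists z.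
    apply: filterS2 (near_img bb') (near_chart_inv bb' nB) => _ [z az <-].
    by rewrite mchartK // => Az; exists z.
  move=> [_ _] /= [[z [az Az] <-] [w [bw Bw] <-]].
  by exists z, w; split => //; exact: (AB (z, w)).
Qed.

Lemma msmooth_at_curve M (c : R -> M) (t : R) :
  smooth_curve c -> msmooth_at (E := R^o) c t.
Proof.
move=> [cc smc]; apply: (@msmooth_at_intro R^o _ _ _ (c t)).
- exact: cc.
- exact: mchart_self.
- apply: smooth_on_smooth_at (smc (c t)) _; last exact: mchart_self.
  apply: open_comp; last exact: chart_dom_open.
  by move=> y _; exact: cc.
Qed.

Lemma smooth_map_id M : smooth_map (@id M).
Proof. by split=> [x|p q]; [exact: cvg_id|exact: manifold_compat]. Qed.

Lemma smooth_map_intro M N (f : M -> N) :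
  (forall p q : M, chart_dom (mchart p) q ->
    msmooth_at (f \o chart_inv (mchart p)) (mchart p q)) -> smooth_map f.
Proof.
move=> smf; split=> [p|p q].
  have pp := mchart_self p.
  (* Near [p] the map [f] factors through the chart at [p], so its continuity is that of the local
     expression. *)
  apply: (@cvg_trans _ ((f \o chart_inv (mchart p)) \o mchart p @ p)).
    by apply: near_eq_cvg; apply: filterS (near_dom pp) => z pz /=; rewrite mchartK.
  have -> : f p = (f \o chart_inv (mchart p)) (mchart p p) by rewrite /= mchartK.
  apply: (@continuous_comp _ _ _ (mchart p) (f \o chart_inv (mchart p))).
    exact: chart_map_continuous.
  exact: (smf p p pp).1.
apply: smooth_at_smooth_on => _ [z [pz /= qz] <-].
by apply: (smf p z pz).2; rewrite /= mchartK.
Qed.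

Lemma smooth_map2l M N P (f : M -> N -> P) (a : M) :
  smooth_map2 f -> smooth_map (f a).
Proof.
move=> smf; apply: smooth_map_intro => p q pq.
exact: (msmooth_at_map2 smf (msmooth_at_cst a _) (msmooth_at_chart_inv pq)).
Qed.

Lemma smooth_map2r M N P (f : M -> N -> P) (b : N) :
  smooth_map2 f -> smooth_map (f^~ b).
Proof.
move=> smf; apply: smooth_map_intro => p q pq.
exact: (msmooth_at_map2 smf (msmooth_at_chart_inv pq) (msmooth_at_cst b _)).
Qed.

Lemma smooth_map_comp M N P (f : M -> N) (g : N -> P) :
  smooth_map f -> smooth_map g -> smooth_map (g \o f).
Proof.
move=> smf smg; apply: smooth_map_intro => p q pq.
apply: (msmooth_at_map smg); apply: (msmooth_at_map smf).
exact: msmooth_at_chart_inv.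
Qed.

(* [tmap], [chart_tangent] and [chart_tangent_inv] are all of this form. *)
Definition chart_diff M N (f : M -> N) (a : M) (b : N) (p : M) :
    {linear 'rV[R]_(mdim M) -> 'rV[R]_(mdim N)} :=
  'd (mchart b \o f \o chart_inv (mchart a)) (mchart a p).

Lemma diff_chain E M N (g : E -> M) (f : M -> N) (x : E) (a : M) (b : N) :
  msmooth_at g x -> smooth_map f ->
  chart_dom (mchart a) (g x) -> chart_dom (mchart b) (f (g x)) ->
  'd (mchart b \o (f \o g)) x = chart_diff f a b (g x) \o 'd (mchart a \o g) x
    :> (E -> _).
Proof.
move=> smg smf ag bfg.
have smag : smooth_at (mchart a \o g) x by exact: smg.2.
have smL : smooth_at (mchart b \o f \o chart_inv (mchart a)) ((mchart a \o g) x).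
  by apply: (msmooth_at_map smf (msmooth_at_chart_inv ag)).2; rewrite /= mchartK.
rewrite (@diff_near _ _ _
  ((mchart b \o f \o chart_inv (mchart a)) \o (mchart a \o g))) //.
- exact: (diff_comp (smooth_at_differentiable smag) (smooth_at_differentiable smL)).
- by apply: smooth_at_comp => //; exact: findim_rV.
- by apply: filterS (msmooth_at_dom smg ag) => y agy /=; rewrite mchartK.
Qed.

(** The charts need not be the ones attached to the points. Taking [f] or [g] to be the identity
    turns this chain rule into the change of charts that carries a tangent vector into a fixed
    chart. *)
Lemma chart_diff_comp M N P (f : M -> N) (g : N -> P) (a p : M) (b : N) (c : P) :
  smooth_map f -> smooth_map g -> chart_dom (mchart a) p ->
  chart_dom (mchart b) (f p) -> chart_dom (mchart c) (g (f p)) ->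
  chart_diff (g \o f) a c p = chart_diff g b c (f p) \o chart_diff f a b p :> (_ -> _).
Proof.
move=> smf smg ap bfp cgfp.
have := @diff_chain _ _ _ (f \o chart_inv (mchart a)) g (mchart a p) b c.
rewrite /= mchartK //; apply => //.
by apply: msmooth_at_map => //; exact: msmooth_at_chart_inv.
Qed.

Lemma chart_diff_id M (a p : M) : chart_dom (mchart a) p ->
  chart_diff id a a p = id :> (_ -> _).
Proof.
move=> ap; apply: diff_id; apply: filterS (near_img ap) => _ [z az <-] /=.
by rewrite mchartK.
Qed.

Lemma tmapE M N (f : M -> N) p v : tmap f p v = chart_diff f p (f p) p v.
Proof. by []. Qed.

Lemma chart_tangentE M (p q : M) v : chart_tangent p q v = chart_diff id q p q v.
Proof. by []. Qed.

Lemma chart_tangent_invE M (p q : M) v : chart_dom (mchart p) q ->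
  chart_tangent_inv p (mchart p q) v = chart_diff id p q q v.
Proof. by move=> pq; rewrite /chart_tangent_inv mchartK. Qed.

Lemma tmap_comp M N P (f : M -> N) (g : N -> P) p v :
  smooth_map f -> smooth_map g -> tmap (g \o f) p v = tmap g (f p) (tmap f p v).
Proof.
move=> smf smg; rewrite !tmapE (chart_diff_comp (b := f p) smf smg) //;
  exact: mchart_self.
Qed.

Lemma tmap_linear M N (f : M -> N) p : linear (tmap f p).
Proof. by move=> a u v; rewrite !tmapE linearP. Qed.

(** The local expression [loc] inside [vf_bracket]: the field carried into the single chart attached
    to [p]. *)
Definition locvf M (p : M) (Z : M -> 'rV[R]_(mdim M)) (y : 'rV[R]_(mdim M)) :=
  chart_tangent p (chart_inv (mchart p) y) (Z (chart_inv (mchart p) y)).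

Lemma locvf_self M (p : M) (Z : M -> 'rV[R]_(mdim M)) :
  locvf p Z (mchart p p) = Z p.
Proof.
rewrite /locvf mchart_selfK chart_tangentE chart_diff_id //.
exact: mchart_self.
Qed.

Lemma vf_bracketE M (X Y : M -> 'rV[R]_(mdim M)) (p : M) :
  smooth_at (locvf p X) (mchart p p) -> smooth_at (locvf p Y) (mchart p p) ->
  vf_bracket X Y p = 'd (locvf p Y) (mchart p p) (X p)
                     - 'd (locvf p X) (mchart p p) (Y p).
Proof.
by move=> smX smY; rewrite /vf_bracket; congr (_ - _); exact: smooth_at_derive.
Qed.

(** Both sides are the differential of [f] at q from the chart at q to the chart at [f p], factored
    once through the chart at [f q] and once through the chart at [p]. It holds on a neighbourhood,
    hence can be differentiated. *)
Lemma locvf_related M N (f : M -> N) X X' p : smooth_map f ->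
  (forall q, tmap f q (X q) = X' (f q)) ->
  \forall y \near mchart p p,
    locvf (f p) X' ((mchart (f p) \o f \o chart_inv (mchart p)) y) =
    'd (mchart (f p) \o f \o chart_inv (mchart p)) y (locvf p X y).
Proof.
move=> smf fX; have pp := mchart_self p.
have nf : \forall q \near p, chart_dom (mchart (f p)) (f q).
  by apply: smf.1; apply: near_dom; exact: mchart_self.
apply: filterS2 (near_img pp) (near_chart_inv pp nf) => _ [q pq <-].
rewrite /= mchartK // => fpq.
have smI := smooth_map_id.
rewrite /locvf !mchartK // -fX chart_tangentE tmapE.
have c1 := chart_diff_comp (a := q) (b := f q) (c := f p) smf (@smI N)
  (mchart_self q) (mchart_self (f q)) fpq.
have c2 := chart_diff_comp (a := q) (b := p) (c := f p) (@smI M) smf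
  (mchart_self q) pq fpq.
rewrite -[LHS]/((chart_diff id (f q) (f p) (f q) \o chart_diff f q (f q) q) (X q)) -c1.
by rewrite -[RHS]/((chart_diff f p (f p) q \o chart_diff id q p q) (X q)) -c2.
Qed.

(* The second derivatives of [f] cancel by symmetry. *)
Lemma vf_bracket_related M N (f : M -> N) X Y X' Y' p : smooth_map f ->
  (forall q, tmap f q (X q) = X' (f q)) ->
  (forall q, tmap f q (Y q) = Y' (f q)) ->
  smooth_at (locvf p X) (mchart p p) -> smooth_at (locvf p Y) (mchart p p) ->
  smooth_at (locvf (f p) X') (mchart (f p) (f p)) ->
  smooth_at (locvf (f p) Y') (mchart (f p) (f p)) ->
  tmap f p (vf_bracket X Y p) = vf_bracket X' Y' (f p).
Proof.
move=> smf fX fY smX smY smX' smY'.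
pose F := mchart (f p) \o f \o chart_inv (mchart p).
pose y0 := mchart p p.
have pp := mchart_self p; have fpp := mchart_self (f p).
have Fy0 : F y0 = mchart (f p) (f p) by rewrite /F /y0 /= mchart_selfK.
have smF : smooth_at F y0.
  by apply: (msmooth_at_map smf (msmooth_at_chart_inv pp)).2; rewrite /= mchartK.
(* Differentiate [locvf_related] along [v]: the chain rule on the left, the product rule on the
   right, where the second derivative of the local expression of [f] appears. *)
have key Z Z' v : (forall q, tmap f q (Z q) = Z' (f q)) ->
    smooth_at (locvf p Z) y0 -> smooth_at (locvf (f p) Z') (F y0) ->
    'd (locvf (f p) Z') (F y0) ('d F y0 v) =
    D2 F y0 v (Z p) + 'd F y0 ('d (locvf p Z) y0 v).
  move=> fZ smZ smZ'.
  have dl := is_diff_apply (A := fun y => 'd F y) (@findim_rV R _)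
    (fun w => smooth_at_diff w smF) smZ.
  have smc : smooth_at (locvf (f p) Z' \o F) y0.
    by apply: smooth_at_comp => //; exact: findim_rV.
  have E1 := @diff_near _ _ _ _ _ _ smc (locvf_related p smf fZ).
  have E2 := @diff_val _ _ _ _ _ _ _ dl.
  have E3 := diff_comp (smooth_at_differentiable smF) (smooth_at_differentiable smZ').
  have E := congr1 (fun h => h v) (etrans (esym E3) (etrans (esym E1) E2)).
  by move: E; rewrite /= locvf_self.
have TX : 'd F y0 (X p) = X' (f p) := fX p.
have TY : 'd F y0 (Y p) = Y' (f p) := fY p.
rewrite !vf_bracketE // -TX -TY -Fy0.
have smX'F : smooth_at (locvf (f p) X') (F y0) by rewrite Fy0.
have smY'F : smooth_at (locvf (f p) Y') (F y0) by rewrite Fy0.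
have kY := key Y Y' (X p) fY smY smY'F.
have kX := key X X' (Y p) fX smX smX'F.
apply/esym/(etrans (congr2 (fun a b => a - b) kY kX)).
have -> := D2_sym (X p) (Y p) (@findim_rV R _) smF.
have -> (a b c : 'rV[R]_(mdim N)) : a + b - (a + c) = b - c.
  by rewrite opprD addrACA subrr add0r.
by rewrite -raddfB.
Qed.

Lemma eq_tmap M N (f g : M -> N) p v : f =1 g -> tmap f p v = tmap g p v.
Proof. by move=> /funext ->. Qed.

Lemma tmap_id M (m : M) v : tmap id m v = v.
Proof. by rewrite tmapE chart_diff_id //; exact: mchart_self. Qed.

End Manifolds.

(** * Lie groups and the adjoint action *)

Section LieGroup.
Variables (R : realType) (G : lieGroupType R).
Local Notation V := 'rV[R]_(mdim G).
Local Notation o := (mchart (1%g : G) 1%g).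
Implicit Types (g h p q : G) (x y z : V).

Lemma msmooth_at_mul (E : normedModType R) (f g : E -> G) (t : E) :
  msmooth_at f t -> msmooth_at g t -> msmooth_at (fun s => (f s * g s)%g) t.
Proof. exact: (msmooth_at_map2 (@mulg_smooth R G)). Qed.

Lemma msmooth_at_inv (E : normedModType R) (f : E -> G) (t : E) :
  msmooth_at f t -> msmooth_at (fun s => (f s)^-1%g) t.
Proof. exact: (msmooth_at_map (@invg_smooth R G)). Qed.

Lemma smooth_mulg g : smooth_map (fun h : G => (g * h)%g).
Proof. exact: smooth_map2l (@mulg_smooth R G). Qed.

Lemma smooth_mulgr g : smooth_map (fun h : G => (h * g)%g).
Proof. exact: smooth_map2r (@mulg_smooth R G). Qed.

Lemma smooth_lconj g : smooth_map (lconj g).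
Proof. exact: smooth_map_comp (smooth_mulg g) (smooth_mulgr g^-1%g). Qed.

Lemma lconj1 g : lconj g 1%g = 1%g.
Proof. by rewrite /lconj mulg1 mulgV. Qed.

Lemma left_inv_vfE q x : left_inv_vf x q = chart_diff (fun h => (q * h)%g) 1%g q 1%g x.
Proof. by rewrite /left_inv_vf tmapE mulg1. Qed.

Lemma left_inv_vf1 x : left_inv_vf x (1%g : G) = x.
Proof.
rewrite left_inv_vfE.
have -> : (fun h : G => (1 * h)%g) = id by apply/funext => h; rewrite mul1g.
by rewrite chart_diff_id //; exact: mchart_self.
Qed.

Lemma tmap_mulg g q x :
  tmap (fun h : G => (g * h)%g) q (left_inv_vf x q) = left_inv_vf x (g * q)%g.
Proof.
have := tmap_comp (1%g : G) x (smooth_mulg q) (smooth_mulg g).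
rewrite /left_inv_vf [(q * 1)%g]mulg1 => <-.
by apply: eq_tmap => h /=; rewrite mulgA.
Qed.

Lemma thetaL_left_inv q x : thetaL q (left_inv_vf x q) = x.
Proof. by rewrite /thetaL tmap_mulg mulVg left_inv_vf1. Qed.

Lemma left_inv_thetaL q (w : V) : left_inv_vf (thetaL q w) q = w.
Proof.
have := tmap_comp q w (smooth_mulg q^-1%g) (smooth_mulg q).
rewrite /left_inv_vf /thetaL [(q^-1 * q)%g]mulVg => <-.
rewrite -[RHS](tmap_id q w); apply: eq_tmap => h /=.
by rewrite mulVKg.
Qed.

Lemma locvf_left_inv p q x : chart_dom (mchart p) q ->
  locvf p (left_inv_vf x) (mchart p q) = chart_diff (fun h => (q * h)%g) 1%g p 1%g x.
Proof.
move=> pq; rewrite /locvf mchartK // chart_tangentE left_inv_vfE.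
have qq := mchart_self q.
have c := chart_diff_comp (a := 1%g) (b := q) (c := p) (p := 1%g)
  (smooth_mulg q) (@smooth_map_id R G) (mchart_self _).
rewrite /= [(q * 1)%g]mulg1 in c.
exact: (esym (congr1 (fun L => L x) (c qq pq))).
Qed.

(** The second factor lies near 1, so the product stays near the first factor and can be read in the
    same chart at [p]. The derivative in the second variable is the left-invariant field. *)
Definition local_mulg p (u : V * V) : V :=
  mchart p (chart_inv (mchart p) u.1 * chart_inv (mchart 1%g) u.2)%g.

Lemma msmooth_at_fst_inv p q (v : V) : chart_dom (mchart p) q ->
  msmooth_at (fun u : V * V => chart_inv (mchart p) u.1) (mchart p q, v).
Proof.
move=> pq; apply: (@msmooth_at_comp _ _ _ _ fst); first exact: findim_rV.
- by apply: (@smooth_at_linear _ _ _ fst) => ?; exact: cvg_fst.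
- exact: msmooth_at_chart_inv.
Qed.

Lemma msmooth_at_snd_inv p q (v : V) : chart_dom (mchart p) q ->
  msmooth_at (fun u : V * V => chart_inv (mchart p) u.2) (v, mchart p q).
Proof.
move=> pq; apply: (@msmooth_at_comp _ _ _ _ snd); first exact: findim_rV.
- by apply: (@smooth_at_linear _ _ _ snd) => ?; exact: cvg_snd.
- exact: msmooth_at_chart_inv.
Qed.

Lemma smooth_at_local_mulg p q : chart_dom (mchart p) q ->
  smooth_at (local_mulg p) (mchart p q, o).
Proof.
move=> pq; have smm := msmooth_at_mul (msmooth_at_fst_inv o pq)
  (msmooth_at_snd_inv (mchart p q) (mchart_self (1%g : G))).
by apply: smm.2; rewrite /= !mchartK ?mulg1 //; exact: mchart_self.
Qed.

Lemma locvf_left_inv_near p q x : chart_dom (mchart p) q ->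
  \forall y \near mchart p q,
    locvf p (left_inv_vf x) y = 'd (fun z => local_mulg p (y, z)) o x.
Proof.
move=> pq; apply: filterS (near_img pq) => _ [r pr <-].
rewrite (locvf_left_inv x pr).
have -> // : (fun z => local_mulg p (mchart p r, z)) =
    mchart p \o (fun h => (r * h)%g) \o chart_inv (mchart 1%g).
by apply/funext => z; rewrite /local_mulg /= (mchartK pr).
Qed.

(** In a chart the field is a partial derivative of the multiplication. *)
Lemma smooth_at_left_inv p q x : chart_dom (mchart p) q ->
  smooth_at (locvf p (left_inv_vf x)) (mchart p q).
Proof.
move=> pq.
apply: (@smooth_at_ext _ _ _ (fun y => 'd (fun z => local_mulg p (y, z)) o x)).
  by apply: filterS (locvf_left_inv_near x pq) => y ->.
exact: (smooth_at_partial2_rV x (smooth_at_local_mulg pq)).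
Qed.

(** Left translation by [p] relates each of the two fields to itself, hence also their bracket. *)
Lemma vf_bracket_left_inv p x y :
  vf_bracket (left_inv_vf x) (left_inv_vf y) p =
  left_inv_vf (lie_bracket (G := G) x y) p.
Proof.
have := vf_bracket_related (p := 1%g) (smooth_mulg p)
  (fun q => tmap_mulg p q x) (fun q => tmap_mulg p q y)
  (smooth_at_left_inv x (mchart_self _)) (smooth_at_left_inv y (mchart_self _))
  (smooth_at_left_inv x (mchart_self _)) (smooth_at_left_inv y (mchart_self _)).
by rewrite mulg1 => <-.
Qed.

(** Conjugation is multiplicative, so lconj g (q h) = (lconj g q) (lconj g h); differentiate in h at
    1. Thus conjugation relates the left-invariant fields of x and Ad_g x, and therefore Ad_g
    preserves brackets. *)
Lemma tmap_lconj g q x :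
  tmap (lconj g) q (left_inv_vf x q) = left_inv_vf (Ad g x) (lconj g q).
Proof.
have := tmap_comp (1%g : G) x (smooth_mulg q) (smooth_lconj g).
rewrite /left_inv_vf [(q * 1)%g]mulg1 => <-.
have := tmap_comp (1%g : G) x (smooth_lconj g) (smooth_mulg (lconj g q)).
rewrite lconj1 => <-; apply: eq_tmap => h /=.
by rewrite /lconj !mulgA mulgVK.
Qed.

Lemma Ad_lie_bracket g x y :
  Ad g (lie_bracket x y) = lie_bracket (G := G) (Ad g x) (Ad g y).
Proof.
have := vf_bracket_related (p := 1%g) (smooth_lconj g)
  (fun q => tmap_lconj g q x) (fun q => tmap_lconj g q y)
  (smooth_at_left_inv x (mchart_self _)) (smooth_at_left_inv y (mchart_self _))
  (smooth_at_left_inv _ (mchart_self _)) (smooth_at_left_inv _ (mchart_self _)).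
by rewrite lconj1.
Qed.

(** This is the mixed second derivative of the multiplication at (1,1), along [v] in the first
    factor and [x] in the second. The bracket is its antisymmetrisation. *)
Definition dleft x v : V := 'd (locvf 1%g (left_inv_vf x)) o v.

Lemma lie_bracketE x y : lie_bracket (G := G) x y = dleft y x - dleft x y.
Proof.
rewrite /lie_bracket vf_bracketE ?left_inv_vf1 //;
  exact: (smooth_at_left_inv _ (mchart_self _)).
Qed.

Lemma dleft_linear v : linear (dleft^~ v).
Proof.
move=> c x y; rewrite /dleft.
have E : locvf 1%g (left_inv_vf (c *: x + y)) =
    c *: locvf 1%g (left_inv_vf x) + locvf (1%g : G) (left_inv_vf y).
  apply/funext => u; rewrite /locvf -[RHS]/(_ *: _ + _) !chart_tangentE.
  by rewrite {1}/left_inv_vf tmap_linear linearP.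
have smx := smooth_at_left_inv x (mchart_self (1%g : G)).
have smy := smooth_at_left_inv y (mchart_self (1%g : G)).
rewrite E.
have h := is_diffD (is_diffZ c (differentiableP (smooth_at_differentiable smx)))
  (differentiableP (smooth_at_differentiable smy)).
exact: (congr1 (fun L => L v) (@diff_val _ _ _ _ _ _ _ h)).
Qed.

Lemma lie_bracketC x y : lie_bracket (G := G) x y = - lie_bracket y x.
Proof. by rewrite !lie_bracketE opprB. Qed.

Lemma dleft_linearr x : linear (dleft x).
Proof. by move=> c v w; rewrite /dleft linearP. Qed.

Lemma lie_bracket_linearr x : linear (lie_bracket (G := G) x).
Proof.
move=> c y z.
have e1 : dleft (c *: y + z) x = c *: dleft y x + dleft z x.
  exact: dleft_linear.
have e2 : dleft x (c *: y + z) = c *: dleft x y + dleft x z.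
  exact: dleft_linearr.
rewrite (lie_bracketE x (c *: y + z)) (lie_bracketE x y) (lie_bracketE x z).
rewrite e1 e2; move: (dleft y x) (dleft z x) (dleft x y) (dleft x z).
by move=> a b a' b'; rewrite scalerBr opprD addrACA.
Qed.

Lemma lie_bracket_linearl y : linear (fun x => lie_bracket (G := G) x y).
Proof.
move=> c x z.
have e : lie_bracket (G := G) y (c *: x + z) =
    c *: lie_bracket y x + lie_bracket (G := G) y z.
  exact: lie_bracket_linearr.
rewrite (lie_bracketC (c *: x + z) y) (lie_bracketC x y) (lie_bracketC z y).
rewrite e; move: (lie_bracket y x) (lie_bracket y z) => a b.
by rewrite opprD scalerN.
Qed.

Lemma Ad1 x : Ad (1%g : G) x = x.
Proof.
rewrite -[RHS](tmap_id (1%g : G) x); apply: eq_tmap => h.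
by rewrite /lconj mul1g invg1 mulg1.
Qed.

Lemma AdM g h x : Ad (g * h)%g x = Ad g (Ad h x).
Proof.
have := tmap_comp (1%g : G) x (smooth_lconj h) (smooth_lconj g).
rewrite lconj1 => E; rewrite /Ad -E; apply: eq_tmap => k /=.
by rewrite /lconj invgM !mulgA.
Qed.

Lemma AdE g x : Ad g x = chart_diff (lconj g) 1%g 1%g 1%g x.
Proof. by rewrite /Ad tmapE lconj1. Qed.

(** Ad is a partial derivative at 1 of (g, h) |-> g h g^-1. *)
Lemma smooth_at_Ad p q x : chart_dom (mchart p) q ->
  smooth_at (fun y => Ad (chart_inv (mchart p) y) x) (mchart p q).
Proof.
move=> pq.
pose K (u : V * V) : V :=
  mchart 1%g (lconj (chart_inv (mchart p) u.1) (chart_inv (mchart (1%g : G)) u.2)).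
have -> : (fun y => Ad (chart_inv (mchart p) y) x) =
    (fun y => 'd (fun z => K (y, z)) o x).
  by apply/funext => y; rewrite AdE.
have smK : smooth_at K (mchart p q, o).
  have s1 := msmooth_at_fst_inv o pq.
  have s2 := msmooth_at_snd_inv (mchart p q) (mchart_self (1%g : G)).
  apply: (msmooth_at_mul (msmooth_at_mul s1 s2) (msmooth_at_inv s1)).2.
  by rewrite /= !mchartK ?mulg1 ?mulgV //; exact: mchart_self.
exact: (smooth_at_partial2_rV x smK).
Qed.

(* Differentiate [T R_h (Ad_h x) = T L_h x] at [h = 1]. *)
Lemma diff_Ad x v :
  'd (fun y => Ad (chart_inv (mchart (1%g : G)) y) x) o v = lie_bracket (G := G) v x.
Proof.
have d1 := mchart_self (1%g : G).
pose f := local_mulg 1%g; have smf : smooth_at f (o, o) := smooth_at_local_mulg d1.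
(* [A y] is the differential at 1 of right translation by the point with coordinates y, and [Z y]
   below is Ad of that point applied to [x]. *)
pose A y : {linear V -> V} := 'd (fun z => f (z, y)) o.
pose Z y := Ad (chart_inv (mchart (1%g : G)) y) x.
have smZ : smooth_at Z o := smooth_at_Ad x d1.
have fo z : f (z, o) = (mchart 1%g \o chart_inv (mchart (1%g : G))) z.
  by rewrite /f /local_mulg /= mchart_selfK mulg1.
have smfC : smooth_at (fun u : V * V => f (u.2, u.1)) (o, o).
  have s1 := msmooth_at_fst_inv o d1; have s2 := msmooth_at_snd_inv o d1.
  by apply: (msmooth_at_mul s2 s1).2; rewrite /= !mchart_selfK mulg1.
have smA w : smooth_at (fun y => A y w) o.
  exact: (smooth_at_partial2_rV w smfC).
have key : \forall y \near o, 'd (fun z => f (y, z)) o x = A y (Z y).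
  apply: filterS (near_img d1) => _ [h dh <-].
  rewrite /A /Z mchartK // AdE.
  have c := chart_diff_comp (a := 1%g) (b := 1%g) (c := 1%g) (p := 1%g)
    (smooth_lconj h) (smooth_mulgr h) d1.
  rewrite lconj1 mul1g in c.
  have e1 : (fun z => f (mchart 1%g h, z)) =
      mchart 1%g \o (fun k => (h * k)%g) \o chart_inv (mchart 1%g).
    by apply/funext => z; rewrite /f /local_mulg /= (mchartK dh).
  have e2 : (fun z => f (z, mchart 1%g h)) =
      mchart 1%g \o (fun k => (k * h)%g) \o chart_inv (mchart 1%g).
    by apply/funext => z; rewrite /f /local_mulg /= (mchartK dh).
  rewrite e1 e2.
  have -> : (fun k : G => (h * k)%g) = (fun k => (k * h)%g) \o lconj h.
    by apply/funext => k /=; rewrite /lconj mulgVK.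
  exact: (congr1 (fun L => L x) (c d1 dh)).
have smL : smooth_at (fun y => 'd (fun z => f (y, z)) o x) o.
  exact: (smooth_at_partial2_rV x smf).
have E1 := congr1 (fun L => L v) (diff_near smL key).
have E2 := congr1 (fun L => L v)
  (@diff_val _ _ _ _ _ _ _ (is_diff_apply (@findim_rV R _) smA smZ)).
have Zo : Z o = x by rewrite /Z mchart_selfK Ad1.
have Ao w : A o w = w.
  rewrite /A.
  have -> : (fun z => f (z, o)) = mchart 1%g \o chart_inv (mchart (1%g : G)).
    exact/funext.
  exact: (congr1 (fun L => L w) (chart_diff_id d1)).
have dleftE a b : dleft a b = 'd (fun y => 'd (fun z => f (y, z)) o a) o b.
  rewrite /dleft; have near1 := locvf_left_inv_near a d1.
  apply: (congr1 (fun L => L b)); apply: diff_near; last first.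
    by apply: filterS near1 => y /esym.
  exact: (smooth_at_partial2_rV a smf).
have E : 'd (fun y => A y x) o v + 'd Z o v = dleft x v.
  have E := etrans (esym E2) E1; cbv beta in E; rewrite Zo in E.
  exact: (etrans (congr1 (+%R _) (esym (Ao _))) (etrans E (esym (dleftE x v)))).
(* In this term [x] sits in the first factor and [v] in the second; exchanging the two derivatives
   recognises [dleft v x], so the derivative of [Z] is the antisymmetrisation. *)
have M : 'd (fun y => A y x) o v = dleft v x.
  rewrite dleftE; symmetry.
  exact: (mixed_partials (@findim_rV R _) (@findim_rV R _) x v
    (@findim_rV R _) smf).
have solve (a b c : V) : a + b = c -> b = c - a.
  by move=> <-; rewrite addrC addKr.
have := solve _ _ _ (etrans (congr1 (fun a => a + 'd Z o v) (esym M)) E).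
by move=> h; exact: (etrans h (esym (lie_bracketE v x))).
Qed.

End LieGroup.

(** * Jacobi identity and Maurer-Cartan equation *)

Section MaurerCartan.
Variables (R : realType) (G : lieGroupType R).
Local Notation V := 'rV[R]_(mdim G).
Local Notation o := (mchart (1%g : G) 1%g).
Local Notation lie := (@lie_bracket R G).

(* Differentiate [Ad_g [a, b] = [Ad_g a, Ad_g b]] at [g = 1]. *)
Lemma jacobi (v a b : V) : lie v (lie a b) = lie (lie v a) b + lie a (lie v b).
Proof.
have d1 := mchart_self (1%g : G).
pose A (x y : V) := Ad (chart_inv (mchart (1%g : G)) y) x.
have AL x x' : A (lie x x') = (fun y => lie (A x y) (A x' y)).
  by apply/funext => y; exact: Ad_lie_bracket.
have Ao x : A x o = x by rewrite /A mchart_selfK Ad1.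
have dA x : 'd (A x) o v = lie v x by exact: diff_Ad.
have smA x : smooth_at (A x) o by exact: smooth_at_Ad.
move: (@lie_bracket_linearr R G) (@lie_bracket_linearl R G) AL dA.
move: (@lie_bracket R G) => L Lr Ll AL dA.
have E : 'd (A (L a b)) o v = L ('d (A a) o v) (A b o) + L (A a o) ('d (A b) o v).
  by rewrite (AL a b); exact: diff_rV_bilinear.
exact: (etrans (esym (dA (L a b))) (etrans E
  (congr2 +%R (congr2 L (dA a) (Ao b)) (congr2 L (Ao a) (dA b))))).
Qed.

Definition local_theta (p : G) (y u : V) : V :=
  thetaL (chart_inv (mchart p) y) (chart_tangent_inv p y u).

Lemma local_theta_linear p y : linear (local_theta p y).
Proof.
move=> c u v; rewrite /local_theta /thetaL -tmap_linear.
by congr (tmap _ _ _); rewrite /chart_tangent_inv linearP.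
Qed.

Definition local_thetaL p y : {linear V -> V} :=
  HB.pack (local_theta p y) (GRing.isLinear.Build _ _ _ _ _ (local_theta_linear p y)).

Lemma local_thetaE p q u : chart_dom (mchart p) q ->
  local_theta p (mchart p q) u = chart_diff (fun h => (q^-1 * h)%g) p 1%g q u.
Proof.
move=> pq; rewrite /local_theta chart_tangent_invE // mchartK // /thetaL tmapE.
have qq := mchart_self q.
have c := chart_diff_comp (a := p) (b := q) (c := 1%g) (p := q)
  (@smooth_map_id R G) (smooth_mulg q^-1%g) pq qq.
rewrite /= mulVg in c.
rewrite [(q^-1 * q)%g]mulVg.
exact: (esym (congr1 (fun L => L u) (c (mchart_self _)))).
Qed.

Lemma local_theta_self p w : local_theta p (mchart p p) w = thetaL p w.
Proof.
rewrite local_thetaE /thetaL ?tmapE; last exact: mchart_self.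
by rewrite [(p^-1 * p)%g]mulVg.
Qed.

(** The form at y is the derivative in z of y^-1 z at the moving point z = y, which calls for
    [smooth_at_partial2] with the identity as [Z]. *)
Lemma smooth_at_local_theta p q u : chart_dom (mchart p) q ->
  smooth_at (fun y => local_theta p y u) (mchart p q).
Proof.
move=> pq.
pose K (u : V * V) : V :=
  mchart (1%g : G) ((chart_inv (mchart p) u.1)^-1 * chart_inv (mchart p) u.2)%g.
have smK : smooth_at K (mchart p q, mchart p q).
  apply: (msmooth_at_mul (msmooth_at_inv (msmooth_at_fst_inv _ pq))
    (msmooth_at_snd_inv _ pq)).2.
  by rewrite /= !mchartK // mulVg; exact: mchart_self.
apply: (@smooth_at_ext _ _ _ (fun y => 'd (fun z => K (y, z)) y u)).
  apply: filterS (near_img pq) => _ [r pr <-].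
  rewrite (local_thetaE u pr).
  have -> // : (fun z => K (mchart p r, z)) =
    mchart 1%g \o (fun h => (r^-1 * h)%g) \o chart_inv (mchart p).
  by apply/funext => z; rewrite /K /= (mchartK pr).
exact: (@smooth_at_partial2 _ _ _ _ K (@findim_rV R _) (@findim_rV R _) id _ u
  (smooth_at_id _) smK).
Qed.

Lemma local_theta_left_inv p q x : chart_dom (mchart p) q ->
  local_theta p (mchart p q) (locvf p (left_inv_vf x) (mchart p q)) = x.
Proof.
move=> pq; rewrite /local_theta /locvf chart_tangent_invE // mchartK //.
rewrite chart_tangentE -[RHS](thetaL_left_inv q x); congr (thetaL _ _).
have smI := @smooth_map_id R G; have qq := mchart_self q.
have c := chart_diff_comp (a := q) (b := p) (c := q) smI smI qq pq qq.
exact: (congr1 (fun L => L (left_inv_vf x q)) (etrans (esym c) (chart_diff_id qq))).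
Qed.

(* Differentiate [theta (X) = x] for the left-invariant field [X] of [x]. *)
Lemma maurer_cartan p (v w : V) :
  'd (fun y => local_theta p y w) (mchart p p) v
  - 'd (fun y => local_theta p y v) (mchart p p) w
  = - lie (thetaL p v) (thetaL p w).
Proof.
have pp := mchart_self p; pose y0 := mchart p p.
(* Each tangent vector at [p] is extended to the left-invariant field through it, read in the chart
   at [p]. *)
pose X (w : V) := locvf p (left_inv_vf (thetaL p w)).
have smX u : smooth_at (X u) y0 := smooth_at_left_inv _ pp.
have X0 u : X u y0 = u by rewrite /X /y0 locvf_self left_inv_thetaL.
have key a b : 'd (fun y => local_theta p y b) y0 a = - thetaL p ('d (X b) y0 a).
  have da := is_diff_apply (A := local_thetaL p) (@findim_rV R _)
    (fun u => smooth_at_local_theta u pp) (smX b).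
  have cst : \forall y \near y0, cst (thetaL p b) y = local_thetaL p y (X b y).
    by apply: filterS (near_img pp) => _ [q pq <-]; rewrite [RHS]local_theta_left_inv.
  have E1 := diff_near (smooth_at_cst (thetaL p b) y0) cst.
  have E := congr1 (fun L => L a) (etrans (esym (@diff_val _ _ _ _ _ _ _ da)) E1).
  have Eb := congr1 (fun u => 'd (fun y => local_thetaL p y u) y0 a) (X0 b).
  have Ec := congr1 (fun L => L a) (diff_cst (thetaL p b) y0).
  have E' : 'd (fun y => local_theta p y b) y0 a + local_theta p y0 ('d (X b) y0 a) = 0.
    exact: (etrans (congr1 (fun u => u + _) (esym Eb)) (etrans E Ec)).
  by rewrite local_theta_self in E'; move/eqP: E'; rewrite addr_eq0 => /eqP.
(* The two fields take the values [v] and [w] at [p], so this difference is their bracket, which is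
   again left-invariant. *)
have B : 'd (X w) y0 v - 'd (X v) y0 w =
    left_inv_vf (lie (thetaL p v) (thetaL p w)) p.
  have e := etrans (esym (vf_bracketE (smX v) (smX w)))
    (vf_bracket_left_inv p (thetaL p v) (thetaL p w)).
  exact: (etrans (congr2 (fun a b => 'd (X w) y0 a - 'd (X v) y0 b)
    (esym (left_inv_thetaL p v)) (esym (left_inv_thetaL p w))) e).
have tB (a b : V) : thetaL p (a - b) = thetaL p a - thetaL p b.
  have := tmap_linear (fun h : G => (p^-1 * h)%g) p (-1) b a.
  rewrite !scaleN1r [- b + a]addrC => E.
  by apply: (etrans E); rewrite addrC.
have solve (a b c : V) : a - b = c -> - a - - b = - c.
  by move=> <-; rewrite opprD.
apply: (etrans (congr2 (fun a b => a - b) (key v w) (key w v))).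
apply: solve; rewrite -tB.
exact: (etrans (congr1 (thetaL p) B) (thetaL_left_inv p _)).
Qed.

End MaurerCartan.

(** * The Cartan 3-form *)

Section LieAlgebra.
Variables (R : realType) (V : lmodType R) (lie : V -> V -> V).
Variable B : V -> V -> R.
Hypothesis Bl : forall v, linear (B^~ v : V -> R^o).
Hypothesis BC : forall u v, B u v = B v u.
Hypothesis lieC : forall x y, lie x y = - lie y x.
Hypothesis jac : forall v a b, lie v (lie a b) = lie (lie v a) b + lie a (lie v b).
Hypothesis Blie : forall v x z, B (lie v x) z = - B x (lie v z).

Let BBl a a' w : B (a - a') w = B a w - B a' w.
Proof. exact: (zmod_morphism_linear (Bl w)). Qed.

Let BBr w a a' : B w (a - a') = B w a - B w a'.
Proof. by rewrite BC BBl BC [B a' w]BC. Qed.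

Let BNr w a : B w (- a) = - B w a.
Proof. by rewrite -[- a]sub0r BBr -(subrr a) BBr subrr sub0r. Qed.

Definition triple (a b c : V) : R := B a (lie b c).

Lemma tripleBl a a' b c : triple (a - a') b c = triple a b c - triple a' b c.
Proof. exact: BBl. Qed.

Lemma triple_swap23 a b c : triple a c b = - triple a b c.
Proof. by rewrite /triple lieC BNr. Qed.

(** Invariance moves the bracket across [B]; with the antisymmetry of the bracket this makes
    [triple] change sign under every transposition. *)
Lemma triple_swap12 a b c : triple b a c = - triple a b c.
Proof.
rewrite /triple -(Blie b a c) [RHS]BC -[RHS]/(triple c b a).
by rewrite triple_swap23 /triple [B c _]BC Blie opprK.
Qed.

(** Moving each bracket with [a] into the other slot turns the sum into [B a] applied to the Jacobi
    identity for [b], [c], [d]. *)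
Lemma lie_jacobi_form a b c d :
  triple (lie a b) c d - triple (lie a c) b d + triple (lie a d) b c = 0.
Proof.
have t x y z : triple (lie a x) y z = triple a x (lie y z).
  rewrite [in LHS]/triple BC -[LHS]/(triple (lie y z) a x).
  by rewrite triple_swap12 triple_swap23 opprK.
rewrite (t b c d) (t c b d) (t d b c) (triple_swap23 a (lie b c) d).
have BD u v : B a (u + v) = B a u + B a v.
  by rewrite -[v]opprK BBr [in RHS]BNr.
have := congr1 (B a) (jac b c d).
rewrite BD -!/(triple a _ _) => ->.
by rewrite addrK subrr.
Qed.

(* Leibniz expansion of [D_v <theta_i, [theta_j, theta_k]>], with [D v i] standing
   for [D_v theta_i]. *)
Definition triple_deriv (D : nat -> nat -> V) (a : nat -> V) (v i j k : nat) :=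
  triple (D v i) (a j) (a k) + triple (a i) (D v j) (a k)
  + triple (a i) (a j) (D v k).

(** The hypothesis is the Maurer-Cartan equation. After rotating every [D] into the first slot,
    [D i j] and [D j i] meet the same complementary pair and cancel up to a bracket. The six
    brackets left pair off by the symmetry of [B] into, up to sign, twice [lie_jacobi_form]. *)
Lemma triple_closed (a : nat -> V) (D : nat -> nat -> V) :
  (forall i j, D i j = D j i - lie (a i) (a j)) ->
  triple_deriv D a 0 1 2 3 - triple_deriv D a 1 0 2 3
  + triple_deriv D a 2 0 1 3 - triple_deriv D a 3 0 1 2 = 0.
Proof.
move=> HD; rewrite /triple_deriv.
have c2 x y z : triple x y z = - triple y x z by rewrite triple_swap12.
have c3 x y z : triple x y z = triple z x y.
  by rewrite triple_swap23 (triple_swap12 z x) opprK.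
have s i j x y : triple (D i j) x y = triple (D j i) x y - triple (lie (a i) (a j)) x y.
  by rewrite HD tripleBl.
have bs x y z t : triple (lie x y) z t = triple (lie z t) x y.
  by rewrite /triple BC.
have J := lie_jacobi_form (a 0) (a 1) (a 2) (a 3).
rewrite !(c2 (a _) (D _ _) _) !(c3 (a _) (a _) (D _ _)).
rewrite (s 0 1) (s 0 2) (s 0 3) (s 1 2) (s 1 3) (s 2 3).
rewrite (bs (a 1) (a 2)) (bs (a 1) (a 3)) (bs (a 2) (a 3)).
move: J; lra.
Qed.

End LieAlgebra.

Section InvariantForm.
Variables (R : realType) (G : lieGroupType R).
Local Notation V := 'rV[R]_(mdim G).
Local Notation o := (mchart (1%g : G) 1%g).
Local Notation lie := (@lie_bracket R G).
Variable B : V -> V -> R^o.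
Hypothesis Bl : forall v, linear (B^~ v).
Hypothesis BC : forall u v, B u v = B v u.
Hypothesis BAd : forall g x y, B (Ad g x) (Ad g y) = B x y.

Lemma inv_form_linearr u : linear (B u).
Proof. by move=> c v w; rewrite BC [B u v]BC [B u w]BC; exact: Bl. Qed.
Let Br := inv_form_linearr.

(** Differentiate the constant function g |-> B (Ad_g x) (Ad_g z) at g = 1 along [v]. *)
Lemma inv_form_lie v x z : B (lie v x) z = - B x (lie v z).
Proof.
have d1 := mchart_self (1%g : G).
pose A (x y : V) := Ad (chart_inv (mchart (1%g : G)) y) x.
have AB : cst (B x z) = (fun y => B (A x y) (A z y)) :> (V -> R^o).
  by apply/funext => y; rewrite /A BAd.
have Ao t : A t o = t by rewrite /A mchart_selfK Ad1.
have dA t : 'd (A t) o v = lie v t by exact: diff_Ad.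
have smA t : smooth_at (A t) o by exact: smooth_at_Ad.
clearbody A.
have E0 : 'd (cst (B x z) : V -> R^o) o v = 0.
  exact: (congr1 (fun L => L v) (diff_cst (B x z) o)).
have E : 'd (cst (B x z) : V -> R^o) o v =
    B ('d (A x) o v) (A z o) + B (A x o) ('d (A z) o v).
  by rewrite AB; exact: diff_rV_bilinear.
have := etrans (esym (etrans E
  (congr2 +%R (congr2 B (dA x) (Ao z)) (congr2 B (Ao x) (dA z))))) E0.
by move/eqP; rewrite addr_eq0 => /eqP.
Qed.

End InvariantForm.

Section CartanForm.
Variables (R : realType) (G : lieGroupType R).
Local Notation V := 'rV[R]_(mdim G).
Local Notation lie := (@lie_bracket R G).
Variable ip : V -> V -> R.
Hypotheses (ip_inner : inner_product ip) (ip_Ad : Ad_invariant ip).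

(** The constant 6/12: the shuffle sum doubles each bracket and the three outer terms coincide. With
    it, [triple] is the Cartan form on left-trivialised vectors. *)
Definition half_ip (x y : V) : R := 2^-1 * ip x y.
Local Notation T := (triple lie half_ip).

Lemma half_ipl v : linear (half_ip^~ v : V -> R^o).
Proof.
have [lin _ _] := ip_inner.
by move=> c x y; rewrite /half_ip lin mulrDr mulrCA.
Qed.

Lemma half_ipC u v : half_ip u v = half_ip v u.
Proof. by have [_ sym _] := ip_inner; rewrite /half_ip sym. Qed.

Lemma half_ipr u : linear (half_ip u : V -> R^o).
Proof. exact: (inv_form_linearr half_ipl half_ipC). Qed.

Lemma half_ip_lie v x z : half_ip (lie v x) z = - half_ip x (lie v z).
Proof.
apply: (inv_form_lie half_ipl half_ipC) => g a b.
by rewrite /half_ip ip_Ad.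
Qed.

Lemma half_tripleC a b c : T a c b = - T a b c.
Proof. exact: (triple_swap23 half_ipl half_ipC (@lie_bracketC R G)). Qed.

Lemma half_triple_swap a b c : T b a c = - T a b c.
Proof. exact: (triple_swap12 half_ipl half_ipC (@lie_bracketC R G) half_ip_lie). Qed.

Lemma cartan_formE g (u : 'I_3 -> V) : cartan_form ip g u =
  T (thetaL g (u (inord 0))) (thetaL g (u (inord 1))) (thetaL g (u (inord 2))).
Proof.
rewrite /cartan_form.
move: (thetaL g (u (inord 0))) (thetaL g (u (inord 1))) (thetaL g (u (inord 2))).
move=> a b c; have [lin sym _] := ip_inner.
(* One factor 2 comes from antisymmetry, the other from the 1/2 in [half_ip]; three such terms
   cancel the 12. *)
have E x y z : ip x (lie y z - lie z y) = 4 * T x y z.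
  rewrite (lie_bracketC z y) opprK /triple /half_ip.
  move: (lie y z) => w; rewrite sym -[w in w + w]scale1r lin scale1r sym.
  lra.
rewrite !E (half_triple_swap a b c) (half_triple_swap a c b) half_tripleC.
lra.
Qed.

Lemma local_cartan_formE p y (u : 'I_3 -> V) :
  local_form (cartan_form ip) p y u =
  T (local_theta p y (u (inord 0))) (local_theta p y (u (inord 1)))
    (local_theta p y (u (inord 2))).
Proof. exact: cartan_formE. Qed.

Section Triple.
Variables (E : normedModType R) (f g h : E -> V) (t : E).
Hypotheses (smf : smooth_at f t) (smg : smooth_at g t) (smh : smooth_at h t).

Let smooth_at_lie : smooth_at (fun y => lie (g y) (h y)) t.
Proof.
exact: (smooth_at_rV_bilinear (@lie_bracket_linearr R G) (@lie_bracket_linearl R G)).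
Qed.

Lemma smooth_at_triple : smooth_at (fun y => T (f y) (g y) (h y) : R^o) t.
Proof. exact: (smooth_at_rV_bilinear half_ipr half_ipl smf smooth_at_lie). Qed.

Lemma diff_triple v : 'd (fun y => T (f y) (g y) (h y) : R^o) t v =
  T ('d f t v) (g t) (h t) + T (f t) ('d g t v) (h t) + T (f t) (g t) ('d h t v).
Proof.
have E1 := diff_rV_bilinear half_ipr half_ipl smf smooth_at_lie v.
have E2 := diff_rV_bilinear (@lie_bracket_linearr R G)
  (@lie_bracket_linearl R G) smg smh v.
have D w w' : half_ip (f t) (w + w') = half_ip (f t) w + half_ip (f t) w'.
  by have := half_ipr (f t) 1 w w'; rewrite !scale1r.
have E3 := etrans (congr1 (half_ip (f t)) E2) (D _ _).
exact: (etrans (etrans E1 (congr1 (+%R _) E3)) (addrA _ _ _)).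
Qed.

End Triple.

Lemma cartan_form_is_form : is_form (cartan_form ip).
Proof.
split.
- move=> p i u c v w at_i; rewrite !cartan_formE /at_i {at_i}.
  have tl : linear (thetaL p) := tmap_linear _ _.
  have e k : (k < 3)%N -> (inord k == i) = (k == i :> nat).
    by move=> k3; rewrite -val_eqE /= inordK.
  have t1 a a' b b' : T (c *: a + a') b b' = c * T a b b' + T a' b b'.
    exact: half_ipl.
  have t2 a a' b b' : T b (c *: a + a') b' = c * T b a b' + T b a' b'.
    rewrite (half_triple_swap (c *: a + a') b) (half_triple_swap a b).
    by rewrite (half_triple_swap a' b) t1 opprD mulrN.
  have t3 a a' b b' : T b b' (c *: a + a') = c * T b b' a + T b b' a'.
    rewrite (half_tripleC b (c *: a + a')) (half_tripleC b a).
    by rewrite (half_tripleC b a') t2 opprD mulrN.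
  rewrite !e //; case: i {e} => [[|[|[|//]]] hi] /=.
  + by rewrite (tl c v w) t1.
  + by rewrite (tl c v w) t2.
  + by rewrite (tl c v w) t3.
- move=> p u i j ij uij; rewrite cartan_formE.
  pose th k := thetaL p (u (inord k)).
  have thij : th i = th j by rewrite /th !inord_val uij.
  have t1 a b : T a a b = 0.
    by apply/eqP; have := half_triple_swap a a b; lra.
  have t2 a b : T b a a = 0.
    by have := half_tripleC b a a; lra.
  have t3 a b : T a b a = 0 by rewrite half_tripleC t1 oppr0.
  rewrite -/(th 0%N) -/(th 1%N) -/(th 2%N).
  move: ij thij; rewrite -val_eqE.
  case: i {uij} => [[|[|[|//]]] hi] /=; case: j => [[|[|[|//]]] hj] //= _ => e;
    by rewrite ?e ?t1 ?t2 ?t3 // -?e ?t1 ?t2 ?t3.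
- move=> p u; apply: smooth_at_smooth_on => _ [q pq <-].
  under eq_fun do rewrite local_cartan_formE.
  by apply: smooth_at_triple; exact: smooth_at_local_theta.
Qed.

Lemma ext_d_cartan_form p u : ext_d (cartan_form ip) p u = 0.
Proof.
have pp := mchart_self p.
pose a k := thetaL p (u (inord k : 'I_4)).
pose D i j :=
  'd (fun y => local_theta p y (u (inord j : 'I_4))) (mchart p p) (u (inord i)).
have HD i j : D i j = D j i - lie (a i) (a j).
  have solve (x y z : V) : x - y = - z -> x = y - z.
    by move=> <-; rewrite addrC subrK.
  exact: solve (maurer_cartan p (u (inord i)) (u (inord j))).
(* [bump i] lists the indices other than [i] in increasing order, so [j0], [j1], [j2] are the
   arguments that remain once [u i] is omitted. *)
have E (i : 'I_4) (j0 j1 j2 : nat) :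
    bump i 0 = j0 -> bump i 1 = j1 -> bump i 2 = j2 ->
    'D_(u i) (fun y => local_form (cartan_form ip) p y
                         (fun j => u (lift i j)) : R^o) (mchart p p) =
    triple_deriv lie half_ip D a i j0 j1 j2.
  move=> b0 b1 b2.
  have l (k : nat) : (k < 3)%N -> lift i (inord k : 'I_3) = inord (bump i k).
    move=> k3; apply: val_inj; rewrite /= !inordK //.
    by rewrite /bump; case: (i <= k)%N; rewrite ?add1n ?add0n // ltnW.
  under eq_fun do rewrite local_cartan_formE !l // b0 b1 b2.
  have sml j := smooth_at_local_theta (u j) pp.
  rewrite smooth_at_derive; last exact: smooth_at_triple.
  have := diff_triple (sml (inord j0)) (sml (inord j1)) (sml (inord j2)) (u i).
  rewrite !local_theta_self => ->.
  by rewrite /triple_deriv /D /a inord_val.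
pose td := triple_deriv lie half_ip D a.
(* The wildcard branch stands for index 3, the last one in the sum. *)
pose F (i : nat) : R := match i with
  0 => td 0 1 2 3 | 1 => td 1 0 2 3 | 2 => td 2 0 1 3 | _ => td 3 0 1 2 end%N.
have -> : ext_d (cartan_form ip) p u = \sum_(i < 4) (-1) ^+ i * F i.
  apply: eq_bigr => -[[|[|[|[|//]]]] hi] _; congr (_ * _); exact: E.
rewrite !big_ord_recl big_ord0 /=.
have := triple_closed half_ipl half_ipC (@lie_bracketC R G) (@jacobi R G)
  half_ip_lie HD.
rewrite -/td /bump /= !addn0 !add1n; move: (td 0 1 2 3)%N (td 1 0 2 3)%N.
move: (td 2 0 1 3)%N (td 3 0 1 2)%N => t3 t2 t0 t1 H.
rewrite expr0 expr1 sqrrN expr1n exprSr sqrrN expr1n.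
move: H; lra.
Qed.

End CartanForm.

(** * Fundamental vector fields and nondegeneracy *)

Section Velocity.
Variable R : realType.
Implicit Types M N : manifoldType R.

Lemma velocityE M (c : R -> M) t : msmooth_at (E := R^o) c t ->
  velocity c t = 'd (mchart (c t) \o c : R^o -> _) t 1.
Proof. by move=> smc; apply: smooth_at_derive; apply: smc.2; exact: mchart_self. Qed.

Lemma velocity_map M N (f : M -> N) (c : R -> M) t :
  smooth_map f -> msmooth_at (E := R^o) c t ->
  velocity (f \o c) t = tmap f (c t) (velocity c t).
Proof.
move=> smf smc; rewrite !velocityE //; last exact: (msmooth_at_map (E := R^o)).
exact: (congr1 (fun L => L 1) (diff_chain (E := R^o) smc smf
  (mchart_self (c t)) (mchart_self (f (c t))))).
Qed.

Lemma msmooth_at_opp M (c : R -> M) : msmooth_at (E := R^o) c 0 ->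
  msmooth_at (E := R^o) (fun t => c (- t)) 0.
Proof.
move=> smc; apply: (@msmooth_at_comp R R^o R^o M (@GRing.opp R^o) c 0).
- exact: findim_R.
- by apply: (@smooth_at_linear _ _ _ (@GRing.opp R^o)) => ?; exact: opp_continuous.
- by rewrite oppr0.
Qed.

Lemma velocity_opp M (c : R -> M) : msmooth_at (E := R^o) c 0 ->
  velocity (fun t => c (- t)) 0 = - velocity c 0.
Proof.
move=> smc; rewrite !velocityE //; last exact: msmooth_at_opp.
have d := smc.2 (c 0) (mchart_self _).
rewrite oppr0.
have cN : continuous (@GRing.opp R^o : R^o -> R^o).
  by move=> ?; exact: opp_continuous.
have dN : differentiable (@GRing.opp R^o : R^o -> R^o) 0.
  exact: linear_differentiable.
have d' : differentiable (mchart (c 0) \o c : R^o -> _) (- 0 : R^o).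
  by rewrite oppr0; exact: smooth_at_differentiable.
apply: (etrans (congr1 (fun L => L 1) (diff_comp dN d'))); rewrite /=.
have -> : 'd (@GRing.opp R^o : R^o -> R^o) 0 1 = - 1.
  exact: (congr1 (fun L => L 1) (diff_lin _ cN)).
by rewrite oppr0 linearN.
Qed.

End Velocity.

(** * Fundamental vector fields and the conjugation action *)

Section ConjugationAction.
Variables (R : realType) (G : lieGroupType R).
Local Notation V := 'rV[R]_(mdim G).
Local Notation o := (mchart (1%g : G) 1%g).
Local Notation lie := (@lie_bracket R G).

(** No exponential map has to be constructed: [fund_vf] supplies the curve, which passes through 1
    at time 0 with velocity [x], and the chain rule does the rest. The sign is that of exp(-t x). *)
Lemma fund_vfE (M : manifoldType R) (act : G -> M -> M) x m v :
  smooth_action act -> fund_vf act x m v -> v = - tmap (act^~ m) 1%g x.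
Proof.
move=> [sma a1 aM] [c [smc cD <-] ->].
have c0 : c 0 = 1%g.
  by apply: (@mulgI _ (c 0)); rewrite -cD addr0 mulg1.
have smc0 := msmooth_at_curve 0 smc.
have smr : smooth_map (act^~ m) := smooth_map2r m sma.
have := velocity_map (c := fun t => c (- t)) smr (msmooth_at_opp smc0).
rewrite oppr0 c0 velocity_opp // => E.
apply: (etrans E); rewrite !tmapE; exact: linearN.
Qed.

(** Fixing one factor at 1 leaves the identity of [G], so both partial derivatives are
    identities. *)
Lemma diff_local_mulg1 (a b : V) : 'd (local_mulg (1%g : G)) (o, o) (a, b) = a + b.
Proof.
have d1 := mchart_self (1%g : G); have smm := @smooth_at_local_mulg R G _ _ d1.
have e1 : 'd (local_mulg (1%g : G)) (o, o) (a, 0) = a.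
  rewrite -(diff_partial1 a smm).
  have -> : (fun y => local_mulg (1%g : G) (y, o)) =
      mchart 1%g \o chart_inv (mchart (1%g : G)).
    by apply/funext => y; rewrite /local_mulg /= mchart_selfK mulg1.
  exact: (congr1 (fun L => L a) (chart_diff_id d1)).
have e2 : 'd (local_mulg (1%g : G)) (o, o) (0, b) = b.
  rewrite -(diff_partial2 b smm).
  have -> : (fun y => local_mulg (1%g : G) (o, y)) =
      mchart 1%g \o chart_inv (mchart (1%g : G)).
    by apply/funext => y; rewrite /local_mulg /= mchart_selfK mul1g.
  exact: (congr1 (fun L => L b) (chart_diff_id d1)).
have -> : (a, b) = (a, 0) + (0, b) :> V * V by congr pair; rewrite ?addr0 ?add0r.
exact: (etrans (linearD _ _ _) (congr2 +%R e1 e2)).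
Qed.

Lemma tmap_mul (M : manifoldType R) (f g : M -> G) p v :
  smooth_map f -> smooth_map g -> f p = 1%g -> g p = 1%g ->
  tmap (fun q => (f q * g q)%g) p v = tmap f p v + tmap g p v.
Proof.
move=> smf smg fp gp.
have pp := mchart_self p; have d1 := mchart_self (1%g : G).
have smI := msmooth_at_chart_inv pp.
have smF : smooth_at (mchart (1%g : G) \o f \o chart_inv (mchart p)) (mchart p p).
  by apply: (msmooth_at_map smf smI).2; rewrite /= mchartK // fp.
have smH : smooth_at (mchart (1%g : G) \o g \o chart_inv (mchart p)) (mchart p p).
  by apply: (msmooth_at_map smg smI).2; rewrite /= mchartK // gp.
set F := (X in smooth_at X) in smF; set H := (X in smooth_at X) in smH.
have Fp : F (mchart p p) = o by rewrite /F /= mchartK // fp.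
have Hp : H (mchart p p) = o by rewrite /H /= mchartK // gp.
have smm := @smooth_at_local_mulg R G _ _ d1.
rewrite !tmapE fp gp mulg1.
have smFH := smooth_at_pair smF smH.
have FHp : (F (mchart p p), H (mchart p p)) = (o, o) by rewrite Fp Hp.
have smm' : smooth_at (local_mulg (1%g : G)) (F (mchart p p), H (mchart p p)).
  by rewrite FHp.
have fE := findim_prod (@findim_rV R (mdim G)) (@findim_rV R (mdim G)).
have near_dom1 (k : M -> G) : smooth_map k -> k p = 1%g ->
    \forall y \near mchart p p,
      chart_dom (mchart (1%g : G)) (k (chart_inv (mchart p) y)).
  move=> smk kp; apply: (msmooth_at_dom (msmooth_at_map smk smI)).
  by rewrite /= mchartK // kp.
have nE : \forall y \near mchart p p, (local_mulg 1%g \o (fun y => (F y, H y))) y =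
    (mchart 1%g \o (fun q => (f q * g q)%g) \o chart_inv (mchart p)) y.
  apply: filterS2 (near_dom1 f smf fp) (near_dom1 g smg gp) => y dfy dgy.
  by rewrite /local_mulg /F /H /= !mchartK.
have E1 := diff_near (smooth_at_comp fE smFH smm') nE.
have E2 := diff_comp (smooth_at_differentiable smFH) (smooth_at_differentiable smm').
have E3 := diff_pair (smooth_at_differentiable smF) (smooth_at_differentiable smH).
have E := congr1 (fun L => L v) (etrans E1 E2).
apply: (etrans E).
have E4 := congr1 (fun L => L v) E3.
apply: (etrans (congr1 ('d (local_mulg 1%g) (F (mchart p p), H (mchart p p))) E4)).
exact: (etrans (congr1 (fun z => 'd (local_mulg (1%g : G)) z _) FHp)
  (diff_local_mulg1 _ _)).
Qed.

Lemma tmap_cst (M N : manifoldType R) (a : N) (p : M) v : tmap (fun=> a) p v = 0.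
Proof.
have := congr1 (fun L => L v) (diff_cst (mchart a a) (mchart p p)).
by [].
Qed.

(** The product g g^-1 is constant; apply the sum rule [tmap_mul] to it. *)
Lemma tmap_invg x : tmap (fun g : G => g^-1%g) 1%g x = - x.
Proof.
have := tmap_mul x (@smooth_map_id R G) (@invg_smooth R G) erefl (invg1 _).
rewrite tmap_id => E.
have E0 : tmap (fun q : G => (id q * q^-1)%g) 1%g x = 0.
  rewrite -(tmap_cst (1%g : G) (1%g : G) x); apply: eq_tmap => g.
  by rewrite /= mulgV.
by apply/eqP; rewrite -addr_eq0 addrC -E E0.
Qed.

(* [g^-1 (h g h^-1)] is the product of [lconj g^-1 h] and [h^-1]. *)
Lemma thetaL_lconj (g : G) x :
  thetaL g (tmap (fun h => lconj h g) 1%g x) = Ad g^-1%g x - x.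
Proof.
have smc : smooth_map (fun h : G => lconj h g).
  apply: smooth_map_intro => p q pq; rewrite /lconj.
  have smI := msmooth_at_chart_inv pq.
  exact: (msmooth_at_mul (msmooth_at_mul smI (msmooth_at_cst g _))
    (msmooth_at_inv smI)).
have := tmap_comp (1%g : G) x smc (smooth_mulg g^-1%g).
rewrite {2}/lconj mul1g invg1 mulg1 => E.
apply: (etrans (esym E)).
have := tmap_mul x (smooth_lconj g^-1%g) (@invg_smooth R G) (lconj1 _) (invg1 _).
rewrite tmap_invg => <-; apply: eq_tmap => h /=.
by rewrite /lconj invgK !mulgA.
Qed.

End ConjugationAction.

(** * Central elements are fixed by Ad when the group is connected *)

Section CentralVector.
Variables (R : realType) (G : lieGroupType R).
Local Notation V := 'rV[R]_(mdim G).
Local Notation lie := (@lie_bracket R G).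
Variable x : V.
Hypothesis cx : forall v, lie v x = 0.

(** Since Ad_z x = Ad_r (Ad_(r^-1 z) x), the derivative at [r] reduces to the one at 1, which is a
    bracket with [x]. *)
Lemma diff_Ad_central (q r : G) : chart_dom (mchart q) r -> forall v,
  'd (fun y => Ad (chart_inv (mchart q) y) x) (mchart q r) v = 0.
Proof.
move=> qr v; have d1 := mchart_self (1%g : G).
pose W y := mchart (1%g : G) (r^-1 * chart_inv (mchart q) y)%g.
have smW' :=
  msmooth_at_mul (msmooth_at_cst r^-1%g (mchart q r)) (msmooth_at_chart_inv qr).
have W1 : chart_dom (mchart (1%g : G)) (r^-1 * chart_inv (mchart q) (mchart q r))%g.
  by rewrite mchartK // mulVg.
have smW : smooth_at W (mchart q r) by exact: smW'.2.
have Wr : W (mchart q r) = mchart (1%g : G) 1%g by rewrite /W mchartK // mulVg.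
pose A y := Ad (chart_inv (mchart (1%g : G)) y) x.
have smA : smooth_at A (W (mchart q r)) by rewrite Wr; exact: smooth_at_Ad.
pose L : {linear V -> V} :=
  HB.pack (Ad r) (GRing.isLinear.Build _ _ _ _ _ (@tmap_linear _ _ _ (lconj r) 1%g)).
have cL : continuous L := @linear_rV_continuous _ _ _ L.
have smAW := smooth_at_comp (@findim_rV R _) smW smA.
have nE : \forall y \near mchart q r, (L \o (A \o W)) y = Ad (chart_inv (mchart q) y) x.
  apply: filterS (msmooth_at_dom smW' W1) => y Wy.
  rewrite /A /W /= [chart_inv (mchart 1%g) _]mchartK //.
  by rewrite -[LHS]/(Ad r _) -AdM mulVKg.
have smLAW := smooth_at_comp (@findim_rV R _) smAW
  (smooth_at_linear (A (W (mchart q r))) cL).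
have E1 := diff_near smLAW nE.
have E2 := @diff_val _ _ _ _ _ _ _
  (is_diff_linear_comp cL (smooth_at_differentiable smAW)).
have E3 := diff_comp (smooth_at_differentiable smW) (smooth_at_differentiable smA).
have E4 : 'd A (W (mchart q r)) ('d W (mchart q r) v) = 0.
  by rewrite Wr; exact: (etrans (diff_Ad _ _) (cx _)).
apply: (etrans (congr1 (fun D => D v) (etrans E1 E2))).
apply: (etrans (congr1 L (etrans (congr1 (fun D => D v) E3) E4))).
exact: linear0.
Qed.

Lemma Ad_locally_constant (q : G) : \forall z \near q, Ad z x = Ad q x.
Proof.
have qq := mchart_self q.
have /nbhs_ballP[e /= e0 be] := near_img qq.
have : \forall z \near q, ball (mchart q q) e (mchart q z).
  by apply: (chart_map_continuous qq); exact: nbhsx_ballx.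
apply: filterS2 (near_dom qq) => z qz ez.
have flat w : ball (mchart q q) e w ->
    differentiable (fun y => Ad (chart_inv (mchart q) y) x) w /\
    forall v, 'd (fun y => Ad (chart_inv (mchart q) y) x) w v = 0.
  move=> /be[r qr <-]; split; last exact: diff_Ad_central.
  by apply: smooth_at_differentiable; exact: smooth_at_Ad.
have C := diff0_ball_cst (@findim_rV R _) flat ez.
exact: (etrans (congr1 (fun h => Ad h x) (esym (mchartK qz)))
  (etrans C (congr1 (fun h => Ad h x) (mchartK qq)))).
Qed.

(** By local constancy both the set of g fixing [x] and its complement are open; the set contains
    1. *)
Lemma Ad_central : connected [set: G] -> forall g : G, Ad g x = x.
Proof.
move=> conG g; pose S := [set g : G | Ad g x = x].
have oS : open S.
  rewrite openE => q Sq; apply: filterS (Ad_locally_constant q) => z.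
  by rewrite /S /= => ->.
have oSC : open (~` S).
  rewrite openE => q Sq; apply: filterS (Ad_locally_constant q) => z.
  by rewrite /S /= => ->.
suff ST : S = setT by rewrite -[_ = _]/(S g) ST.
apply: conG.
- by exists 1%g; exact: Ad1.
- by exists S => //; rewrite setTI.
- by exists S; [rewrite -[S]setCK; exact: open_closedC|rewrite setTI].
Qed.

End CentralVector.

Lemma inner_contractB (R : realType) (V : lmodType R) k (a : ('I_k.+1 -> V) -> R)
    (v w : V) u : multilinear a ->
  inner_contract (v - w) a u = inner_contract v a u - inner_contract w a u.
Proof.
move=> lin.
(* The default 0 fills slot [ord0], which multilinearity overwrites with the contracted vector. *)
pose u' (i : 'I_k.+1) := if unlift ord0 i is Some j then u j else 0.
have E z : inner_contract z a u = a (fun j => if j == ord0 then z else u' j).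
  congr (a _); apply/funext => j; rewrite /u'.
  by case: unliftP => [i ->|->]; rewrite ?eqxx // eq_sym (negPf (neq_lift _ _)).
have := lin ord0 u' (-1) w v.
by rewrite /= !E scaleN1r addrC mulN1r => ->; rewrite addrC.
Qed.

Lemma inner_contract_eq (R : realType) (V : lmodType R) k
    (a : ('I_k.+1 -> V) -> R) (v w : V) u : multilinear a ->
  inner_contract v a = inner_contract w a -> inner_contract (v - w) a u = 0.
Proof. by move=> lin e; rewrite inner_contractB // e subrr. Qed.

(** * The kernel of the Cartan form along the moment map *)

Section Nondegeneracy.
Variables (R : realType) (G : lieGroupType R).
Local Notation V := 'rV[R]_(mdim G).
Local Notation lie := (@lie_bracket R G).

Lemma Ad_linear (g : G) : linear (Ad g).
Proof. exact: tmap_linear. Qed.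

Lemma AdN (g : G) x : Ad g (- x) = - Ad g x.
Proof.
have AdB u v : Ad g (u - v) = Ad g u - Ad g v.
  exact: (zmod_morphism_linear (Ad_linear g)).
by rewrite -[- x]sub0r AdB -(subrr x) AdB subrr sub0r.
Qed.

(** Equivariance carries the orbit map of [m] to the conjugation orbit of [mu m], where
    [thetaL_lconj] applies to [- x]. *)
Lemma thetaL_fund_vf (M : manifoldType R) (act : G -> M -> M) (mu : M -> G)
    x m v : smooth_action act -> smooth_map mu ->
  (forall g m, mu (act g m) = lconj g (mu m)) -> fund_vf act x m v ->
  thetaL (mu m) (tmap mu m v) = x - Ad (mu m)^-1%g x.
Proof.
move=> act_action smu mu_eq /(fund_vfE act_action) ->.
have [sma act1 _] := act_action.
have E := tmap_comp (1%g : G) (- x) (smooth_map2r m sma) smu.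
rewrite act1 in E.
have tN (M' N' : manifoldType R) (f : M' -> N') p w : tmap f p (- w) = - tmap f p w.
  by rewrite !tmapE; exact: linearN.
rewrite -tN -E.
have -> : tmap (mu \o act^~ m) 1%g (- x) = tmap (fun h => lconj h (mu m)) 1%g (- x).
  by apply: eq_tmap => h; exact: mu_eq.
apply: (etrans (thetaL_lconj (mu m) (- x))).
by rewrite AdN opprK addrC.
Qed.

Variable ip : V -> V -> R.
Hypotheses (ip_inner : inner_product ip) (ip_Ad : Ad_invariant ip).

(** [thetaL g] is onto, with [left_inv_vf] providing preimages, so a contraction that vanishes on
    all [u] controls all pairs [y], [z] of the Lie algebra. *)
Lemma cartan_form_contract (g : G) w y z : exists u,
  inner_contract w (cartan_form ip g) u = triple lie (half_ip ip) (thetaL g w) y z.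
Proof.
exists (fun i => left_inv_vf (if i == ord0 then y else z) g).
rewrite /inner_contract (cartan_formE ip_inner ip_Ad).
have -> : inord 0 = ord0 :> 'I_3.
  by apply: val_inj; rewrite /= inordK.
have -> : inord 1 = lift ord0 (ord0 : 'I_2) :> 'I_3.
  by apply: val_inj; rewrite /= inordK.
have -> : inord 2 = lift ord0 (ord_max : 'I_2) :> 'I_3.
  by apply: val_inj; rewrite /= inordK.
by rewrite unlift_none !liftK /= !thetaL_left_inv.
Qed.

(** For t = [thetaL g w], orthogonal to all brackets, invariance gives <[v,t],[v,t]> =
    -<t,[v,[v,t]]> = 0, and positivity yields [v,t] = 0 for every v. *)
Lemma cartan_form_ker_central (g : G) w : connected [set: G] ->
  (forall u, inner_contract w (cartan_form ip g) u = 0) ->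
  forall h : G, Ad h (thetaL g w) = thetaL g w.
Proof.
move=> conG w0; apply: Ad_central => // v.
have T0 y z : half_ip ip (thetaL g w) (lie y z) = 0.
  by have [u E] := cartan_form_contract g w y z; rewrite w0 in E; rewrite [LHS](esym E).
have := half_ip_lie ip_inner ip_Ad v (thetaL g w) (lie v (thetaL g w)).
rewrite T0 oppr0; move: (lie v _) => t /eqP; rewrite /half_ip mulf_eq0.
rewrite invr_eq0 pnatr_eq0 /= => /eqP t0.
apply/eqP/negPn/negP => tn; have [_ _ /(_ t tn)] := ip_inner.
by rewrite t0 ltxx.
Qed.

Lemma form_ker_linear0 (W : lmodType R) k (a : ('I_k.+1 -> W) -> R) :
  multilinear a -> inner_contract 0 a = fun=> 0.
Proof.
by move=> lin; apply/funext => u; rewrite -(subrr (0 : W)) inner_contractB // subrr.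
Qed.

End Nondegeneracy.

Theorem theorem8p3 (R : realType) (G : lieGroupType R)
    (G_compact : compact [set: G]) (G_connected : connected [set: G])
    (ip : 'rV[R]_(mdim G) -> 'rV[R]_(mdim G) -> R)
    (ip_inner : inner_product ip) (ip_Ad : Ad_invariant ip)
    (M : manifoldType R) (act : G -> M -> M) (act_action : smooth_action act)
    (omega : preform M 2) (omega_form : is_form omega)
    (omega_inv : invariant_form act omega)
    (mu : M -> G) (mu_smooth : smooth_map mu)
    (mu_equivariant : forall g m, mu (act g m) = lconj g (mu m))
    (QH1 : ext_d omega = pullback mu (cartan_form ip))
    (QH2 : forall (x : 'rV[R]_(mdim G)) (m : M) (v : 'rV[R]_(mdim M)),
      fund_vf act x m v ->
      inner_contract v (omega m) =
        fun u => 2^-1 * pullback mu (theta_sum ip x) m u) :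
  let varpi : relform G M 2 := (cartan_form ip, omega) in
  [/\ rel_pre_2plectic mu varpi,
      (forall m : M,
         form_ker (omega m) =
           [set v | exists2 x : 'rV[R]_(mdim G),
                      Ad (mu m) x + x = 0 & fund_vf act x m v]) ->
      rel_2plectic mu varpi &
      rel_nondegenerate mu varpi ->
      forall m : M, form_ker (omega m) `&` [set w | tmap mu m w = 0] = [set 0]].
Proof.
move=> varpi.
have eta_form := cartan_form_is_form ip_inner ip_Ad.
have pre : rel_pre_2plectic mu varpi.
  split => //; congr pair; apply/funext => p; apply/funext => u /=.
    exact: ext_d_cartan_form.
  by rewrite QH1 subrr.
have [eta_lin _ _] := eta_form; have [omega_lin _ _] := omega_form.
split; first exact: pre.
- move=> QH3; split; first exact: pre.
  (* Both components of the map are linear in the vector, so injectivity is tested on [w1 - w2]. *)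
  move=> m w1 w2 e12.
  have e1 : inner_contract (tmap mu m w1) (cartan_form ip (mu m)) =
    inner_contract (tmap mu m w2) (cartan_form ip (mu m)) := congr1 fst e12.
  have e2 : inner_contract w1 (omega m) = inner_contract w2 (omega m) :=
    congr1 snd e12.
  have k1 u : inner_contract (tmap mu m (w1 - w2)) (cartan_form ip (mu m)) u = 0.
    rewrite [tmap _ _ _](zmod_morphism_linear (@tmap_linear _ _ _ mu m)).
    exact: inner_contract_eq (eta_lin _) e1.
  have : form_ker (omega m) (w1 - w2).
    by apply/funext => u; exact: inner_contract_eq (omega_lin _) e2.
  rewrite QH3 => -[x Adx fw].
  have Ad_x : Ad (mu m) x = - x by apply/eqP; rewrite -addr_eq0 Adx.
  have AdVx : Ad (mu m)^-1%g x = - x.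
    have := AdM (mu m)^-1%g (mu m) x.
    by rewrite mulVg Ad1 Ad_x AdN => E; rewrite [in RHS]E opprK.
  have th := thetaL_fund_vf act_action mu_smooth mu_equivariant fw.
  rewrite AdVx opprK in th.
  have := cartan_form_ker_central ip_inner ip_Ad G_connected k1 (mu m).
  rewrite th => AdD.
  have x0 : x = 0.
    have := Ad_linear (mu m) 1 x x.
    rewrite !scale1r AdD Ad_x => E.
    (* The vector 2x is fixed by Ad_(mu m) and also sent to -2x. *)
    have /eqP : x *+ 4 = 0.
      by rewrite (mulrnDr x 2 2) mulr2n {1}E -opprD addNr.
    by rewrite -scaler_nat scaler_eq0 pnatr_eq0 /= => /eqP.
  have := fund_vfE act_action fw.
  rewrite x0 => w0; apply/eqP; rewrite -subr_eq0 w0 oppr_eq0; apply/eqP.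
  exact: (linear0 (chart_diff (act^~ m) 1%g (act 1%g m) 1%g)).
- move=> nd m; have ic0 := form_ker_linear0.
  have t0 : tmap mu m 0 = 0 by exact: (linear0 (chart_diff mu m (mu m) m)).
  apply/seteqP; split=> w /=; last by move=> ->; split => //; exact: ic0.
  (* A vector in both kernels has the same pair of contractions as 0. *)
  by move=> [kw tw]; apply: (nd m); rewrite /= tw t0 ic0 // kw ic0.
Qed.
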